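(* Let $g\ge 1$. For every homomorphism $k\in\mathrm{Hom}(\mathbb{Z}^{2g},\mathbb{R})$ let $\Delta_k:W_1(g)\to W_1(g)\wedge W_1(g)$ be the $\mathbb{R}$-linear map given on the basis of monomials by $$\Delta_k(x_1^{a_1}y_1^{b_1}\cdots x_g^{a_g}y_g^{b_g})=k(a_1,b_1,\dots,a_g,b_g)\,x_1^{a_1}y_1^{b_1}\cdots x_g^{a_g}y_g^{b_g}\wedge 1 .$$ Then $k\mapsto[\Delta_k]$ defines an isomorphism $$\mathrm{Hom}(\mathbb{Z}^{2g},\mathbb{R})\cong H^1(W_1(g),W_1(g)\wedge W_1(g)).$$
   Context: $S$ is a closed connected oriented surface of genus $g>0$ and $(x_1,y_1,\dots,x_g,y_g)$ are fixed symplectic generators of $\pi_1(S)$; the same letters denote their images in $\pi_1(S)^{\mathrm{Ab}}\cong\mathbb{Z}^{2g}$ (written multiplicatively). $W_1(g)$ is the Lie algebra generated by the Wilson loops on the moduli space of flat $\mathrm{GL}(1,\mathbb{R})$-bundles over $S$; it is identified with the group algebra $\mathbb{R}\pi_1(S)^{\mathrm{Ab}}=\mathbb{R}[x_1^{\pm1},y_1^{\pm1},\dots,x_g^{\pm1},y_g^{\pm1}]$, with Lie bracket the bilinear extension of $\{Z_1,Z_2\}=i(Z_1,Z_2)Z_1Z_2$ for $Z_1,Z_2\in\pi_1(S)^{\mathrm{Ab}}$, where $i$ is the algebraic intersection form: $i(x_1^{a_1}y_1^{b_1}\cdots x_g^{a_g}y_g^{b_g},\,x_1^{a'_1}y_1^{b'_1}\cdots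 x_g^{a'_g}y_g^{b'_g})=\sum_{j=1}^g(a_jb'_j-a'_jb_j)$. $W_1(g)\wedge W_1(g)$ is the exterior square over $\mathbb{R}$, a $W_1(g)$-module via $Z_0\cdot(Z_1\wedge Z_2)=\{Z_0,Z_1\}\wedge Z_2+Z_1\wedge\{Z_0,Z_2\}$. For a real Lie algebra $\mathfrak{g}$ and a left $\mathfrak{g}$-module $M$: $Z^1(\mathfrak{g},M)$ is the space of linear maps $f:\mathfrak{g}\to M$ with $\gamma_0\cdot f(\gamma_1)-\gamma_1\cdot f(\gamma_0)-f([\gamma_0,\gamma_1])=0$ for all $\gamma_0,\gamma_1$; $B^1(\mathfrak{g},M)$ is the image of $d:M\to Z^1(\mathfrak{g},M)$, $d(m)(\gamma)=\gamma\cdot m$; and $H^1(\mathfrak{g},M)=Z^1(\mathfrak{g},M)/B^1(\mathfrak{g},M)$. $[\Delta]$ denotes the cohomology class of $\Delta$. *)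

(* Defs.v *)
From HB Require Import structures.
From mathcomp Require Import all_boot all_order all_algebra.
From mathcomp Require Import finmap.
From mathcomp Require Import boolp functions reals.
From mathcomp Require Import monalg.
From mathcomp Require Import ring.

Set Implicit Arguments.
Unset Strict Implicit.
Unset Printing Implicit Defensive.

Import GRing.Theory Num.Theory.

Local Open Scope ring_scope.
Local Open Scope quotient_scope.

(* Linear extension to the free module {malg R[K]} of a map given on the      *)
(* basis (<< k >>)_(k : K).                                                   *)
Section Linext.
Variables (R : comNzRingType) (K : choiceType) (N : lmodType R).
Implicit Types (f : K -> N) (x y : {malg R[K]}).

Definition linext f x : N := \sum_(k <- msupp x) x@_k *: f k.

Lemma linextEw f (d : {fset K}) x : (msupp x `<=` d)%fset ->
  linext f x = \sum_(k <- d) x@_k *: f k.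
Proof.
move=> le_d; rewrite /linext (big_fset_incl _ le_d) //= => k _.
by move=> /mcoeff_outdom ->; rewrite scale0r.
Qed.

Lemma linext_linear f : linear (linext f).
Proof.
move=> a x y; pose d := (msupp x `|` msupp y `|` msupp (a *: x + y))%fset.
rewrite !(@linextEw f d) /d ?fsubsetUr //; first last.
- by rewrite -fsetUA fsubsetUl.
- by apply: fsubset_trans (fsubsetUl _ _); rewrite fsubsetUr.
rewrite scaler_sumr -big_split /=; apply: eq_bigr => k _.
by rewrite mcoeffD mcoeffZ scalerDl scalerA.
Qed.

HB.instance Definition _ f :=
  GRing.isLinear.Build R {malg R[K]} N _ (linext f) (linext_linear f).

Lemma linextU f k : linext f << k >> = f k.
Proof.
by rewrite (@linextEw f _ _ msuppU_le) big_seq_fset1 mcoeffUU scale1r.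
Qed.

Lemma malg_lin_ind (P : {malg R[K]} -> Prop) : P 0 -> (forall k, P << k >>) ->
  (forall a x y, P x -> P y -> P (a *: x + y)) -> forall x, P x.
Proof.
move=> P0 PU PD x; rewrite (monalgE x).
elim: (enum_fset (msupp x)) => [|k s IHs]; first by rewrite big_nil.
rewrite big_cons.
suff -> : << x@_k *g k >> = x@_k *: << k >> :> {malg R[K]} by exact: PD.
by apply/malgP => l; rewrite mcoeffZ !mcoeffU mulr_natr.
Qed.

Lemma linext_ext (F G : {linear {malg R[K]} -> N}) :
  (forall k, F << k >> = G << k >>) -> F =1 G.
Proof.
move=> FG; apply: malg_lin_ind => [|//|a x y Fx Fy]; first by rewrite !linear0.
by rewrite !linearP Fx Fy.
Qed.

End Linext.

(* Quotient of a module by a submodule P: Quotient.quot with its scaling.     *)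
Section QuotLmodule.
Variables (R : comNzRingType) (V : lmodType R) (P : submodClosed V).

Definition submod_zmod : {pred V} := P.
HB.instance Definition _ := GRing.isZmodClosed.Build V submod_zmod
  (GRing.submod_closedB (GRing.submodClosedP P)).

Definition lmodquot : Type := Quotient.quot submod_zmod.
HB.instance Definition _ := GRing.Zmodule.on lmodquot.

Definition lmodpi (x : V) : lmodquot := \pi_(Quotient.quot submod_zmod) x.

Lemma lmodpiP x y : lmodpi x = lmodpi y <-> x - y \in P.
Proof.
rewrite (Quotient.idealrBE submod_zmod).
by split=> [h|/eqP h]; [apply/eqP|]; exact: h.
Qed.

Definition lmodrepr (q : lmodquot) : V := repr (q : Quotient.quot submod_zmod).

Lemma lmodreprK : cancel lmodrepr lmodpi.
Proof. by move=> q; rewrite /lmodpi /lmodrepr reprK. Qed.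

Lemma lmodpi_zmod : zmod_morphism lmodpi.
Proof. by move=> x y; rewrite /lmodpi !piE. Qed.

Definition lmodquot_scale (a : R) (q : lmodquot) : lmodquot :=
  lmodpi (a *: lmodrepr q).

Lemma lmodquot_scaleE a x : lmodquot_scale a (lmodpi x) = lmodpi (a *: x).
Proof.
by apply/lmodpiP; rewrite -scalerBr rpredZ //; apply/lmodpiP; rewrite lmodreprK.
Qed.

HB.instance Definition _ :=
  GRing.isZmodMorphism.Build V lmodquot lmodpi lmodpi_zmod.

Fact lmodquot_scaleA a b q :
  lmodquot_scale a (lmodquot_scale b q) = lmodquot_scale (a * b) q.
Proof. by rewrite -(lmodreprK q) !lmodquot_scaleE scalerA. Qed.

Fact lmodquot_scale1 : left_id 1 lmodquot_scale.
Proof. by move=> q; rewrite -(lmodreprK q) lmodquot_scaleE scale1r. Qed.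

Fact lmodquot_scaleDr : right_distributive lmodquot_scale +%R.
Proof.
move=> a q r; rewrite -(lmodreprK q) -(lmodreprK r) -raddfD.
by rewrite !lmodquot_scaleE scalerDr raddfD.
Qed.

Fact lmodquot_scaleDl q : {morph lmodquot_scale^~ q : a b / a + b}.
Proof.
by move=> a b; rewrite -(lmodreprK q) !lmodquot_scaleE scalerDl raddfD.
Qed.

HB.instance Definition _ := GRing.Zmodule_isLmodule.Build R lmodquot
  lmodquot_scaleA lmodquot_scale1 lmodquot_scaleDr lmodquot_scaleDl.

Fact lmodpi_scalable : scalable lmodpi.
Proof. by move=> a x; rewrite -lmodquot_scaleE. Qed.

HB.instance Definition _ :=
  GRing.isScalable.Build R V lmodquot *:%R lmodpi lmodpi_scalable.

End QuotLmodule.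

(* The submodule generated by S, as the intersection of the submodules        *)
(* containing S.                                                              *)
Section Span.
Variables (R : comNzRingType) (V : lmodType R) (S : V -> Prop).

Definition lmodspan : {pred V} := [pred x | `[< forall P : submodClosed V,
  (forall s, S s -> s \in P) -> x \in P >]].

Lemma lmodspan_gen s : S s -> s \in lmodspan.
Proof. by move=> Ss; apply/asboolP => P; apply. Qed.

Lemma lmodspan_min (P : submodClosed V) :
  (forall s, S s -> s \in P) -> {subset lmodspan <= P}.
Proof. by move=> SP x /asboolP; apply. Qed.

Fact lmodspan_submod : submod_closed lmodspan.
Proof.
split=> [|a x y /asboolP Px /asboolP Py]; apply/asboolP => P SP.
  exact: rpred0.
by rewrite rpredD ?rpredZ ?Px ?Py.
Qed.

HB.instance Definition _ :=
  GRing.isSubmodClosed.Build R V lmodspan lmodspan_submod.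

End Span.

(* The exterior square of V: the quotient of the free module on V * V by the  *)
(* relations making (u, v) |-> u /\ v bilinear and alternating.               *)
Section ExteriorSquare.
Variables (R : comNzRingType) (V : lmodType R).
Local Notation F := {malg R[(V * V)%type]}.

Variant ext2_rel : F -> Prop :=
| Ext2Linl a u v w :
    ext2_rel (<< (a *: u + v, w) >> - (a *: << (u, w) >> + << (v, w) >>))
| Ext2Linr a u v w :
    ext2_rel (<< (w, a *: u + v) >> - (a *: << (w, u) >> + << (w, v) >>))
| Ext2Alt u : ext2_rel << (u, u) >>.

Definition ext2 : Type := lmodquot (lmodspan ext2_rel).
HB.instance Definition _ := GRing.Lmodule.on ext2.

Definition wedge (u v : V) : ext2 := lmodpi (lmodspan ext2_rel) << (u, v) >>.

Lemma wedge_linl w : linear (wedge^~ w).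
Proof.
move=> a u v; rewrite /wedge -linearP; apply/lmodpiP.
by apply: lmodspan_gen; exact: Ext2Linl.
Qed.

Lemma wedge_linr w : linear (wedge w).
Proof.
move=> a u v; rewrite /wedge -linearP; apply/lmodpiP.
by apply: lmodspan_gen; exact: Ext2Linr.
Qed.

Lemma wedgexx u : wedge u u = 0.
Proof.
rewrite /wedge -(raddf0 (lmodpi (lmodspan ext2_rel))); apply/lmodpiP.
by rewrite subr0; apply: lmodspan_gen; exact: Ext2Alt.
Qed.

Lemma wedgeDl u v w : wedge (u + v) w = wedge u w + wedge v w.
Proof. by have := wedge_linl w 1 u v; rewrite !scale1r. Qed.

Lemma wedgeDr u v w : wedge w (u + v) = wedge w u + wedge w v.
Proof. by have := wedge_linr w 1 u v; rewrite !scale1r. Qed.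

Lemma wedgeBl u v w : wedge (u - v) w = wedge u w - wedge v w.
Proof. by rewrite addrC -!scaleN1r wedge_linl addrC. Qed.

Lemma wedgeBr u v w : wedge w (u - v) = wedge w u - wedge w v.
Proof. by rewrite addrC -!scaleN1r wedge_linr addrC. Qed.

Lemma wedgeC u v : wedge u v = - wedge v u.
Proof.
apply/eqP; rewrite -addr_eq0; have := wedgexx (u + v).
by rewrite wedgeDl !wedgeDr !wedgexx add0r addr0 => ->.
Qed.

Lemma ext2_lin_ind (P : ext2 -> Prop) : P 0 -> (forall u v, P (wedge u v)) ->
  (forall a q r, P q -> P r -> P (a *: q + r)) -> forall q, P q.
Proof.
move=> P0 PU PD q; rewrite -(lmodreprK q).
elim/malg_lin_ind: (lmodrepr q) => [|[u v]|a x y Px Py].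
- by rewrite linear0.
- exact: PU.
- by rewrite linearP; exact: PD.
Qed.

(* Universal property of the exterior square. *)
Section Lift.
Variables (N : lmodType R) (b : V -> V -> N).

Definition ext2_lift (q : ext2) : N :=
  linext (fun p => b p.1 p.2) (lmodrepr q).

Hypothesis b_linl : forall w, linear (b^~ w).
Hypothesis b_linr : forall w, linear (b w).
Hypothesis b_alt : forall u, b u u = 0.

Lemma ext2_lift_pi x :
  ext2_lift (lmodpi (lmodspan ext2_rel) x) = linext (fun p => b p.1 p.2) x.
Proof.
pose B : {linear F -> N} := linext (fun p : V * V => b p.1 p.2).
pose kerB : {pred F} := [pred y | B y == 0].
have kerBP : submod_closed kerB.
  split=> [|a y z]; rewrite !inE; first by rewrite linear0.
  by move=> /eqP By /eqP Bz; rewrite linearP By Bz scaler0 addr0.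
pose kM := GRing.isSubmodClosed.Build R F kerB kerBP.
pose kerB_sub : submodClosed F := HB.pack kerB kM.
apply/eqP; rewrite -subr_eq0 -linearB.
suff sub_ker: {subset lmodspan ext2_rel <= kerB_sub}.
  by apply: sub_ker; apply/lmodpiP; rewrite lmodreprK.
have BU u v : B << (u, v) >> = b u v by rewrite /B /= linextU.
apply: lmodspan_min => s -[a u v w|a u v w|u]; rewrite inE; apply/eqP.
- by rewrite linearB linearP !BU b_linl subrr.
- by rewrite linearB linearP !BU b_linr subrr.
- by rewrite BU b_alt.
Qed.

Lemma ext2_liftE u v : ext2_lift (wedge u v) = b u v.
Proof. by rewrite ext2_lift_pi linextU. Qed.

Lemma ext2_lift_linear : linear ext2_lift.
Proof.
move=> a q r; rewrite -(lmodreprK q) -(lmodreprK r) -linearP !ext2_lift_pi.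
by rewrite linearP.
Qed.

End Lift.
End ExteriorSquare.

HB.mixin Record isLieAlgebra (R : comNzRingType) L of GRing.Lmodule R L := {
  lie : L -> L -> L;
  lie_linl : forall z, linear (lie^~ z);
  lie_linr : forall z, linear (lie z);
  liexx : forall x, lie x x = 0;
  lie_jacobi : forall x y z,
    lie x (lie y z) + lie y (lie z x) + lie z (lie x y) = 0
}.

#[short(type="lieAlgType")]
HB.structure Definition LieAlgebra (R : comNzRingType) :=
  {L of GRing.Lmodule R L & isLieAlgebra R L}.

HB.mixin Record isLieModule (R : comNzRingType) (L : lieAlgType R) M
    of GRing.Lmodule R M := {
  act : L -> M -> M;
  act_linl : forall m, linear (act^~ m);
  act_linr : forall x, linear (act x);
  act_lie : forall x y m, act (lie x y) m = act x (act y m) - act y (act x m)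
}.

#[short(type="lieModType")]
HB.structure Definition LieModule (R : comNzRingType) (L : lieAlgType R) :=
  {M of GRing.Lmodule R M & isLieModule R L M}.

Section LieAlgebraTheory.
Variables (R : comNzRingType) (L : lieAlgType R).
Implicit Types x y z : L.

HB.instance Definition _ x :=
  GRing.isLinear.Build R L L _ (@lie R L x) (lie_linr x).

Lemma lieDl x y z : lie (x + y) z = lie x z + lie y z.
Proof. by have := lie_linl z 1 x y; rewrite !scale1r. Qed.

Lemma lieDr x y z : lie x (y + z) = lie x y + lie x z.
Proof. exact: linearD. Qed.

Lemma lieNr x y : lie x (- y) = - lie x y.
Proof. exact: linearN. Qed.

Lemma lieC x y : lie x y = - lie y x.
Proof.
apply/eqP; rewrite -addr_eq0; have := liexx (x + y).
by rewrite lieDl !lieDr !liexx add0r addr0 => ->.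
Qed.

Lemma lie_lie x y z : lie (lie x y) z = lie x (lie y z) - lie y (lie x z).
Proof.
have := lie_jacobi x y z; rewrite [lie z x]lieC lieNr [lie z _]lieC => /eqP.
by rewrite subr_eq0 => /eqP ->.
Qed.

End LieAlgebraTheory.

Section LieModuleTheory.
Variables (R : comNzRingType) (L : lieAlgType R) (M : lieModType L).

HB.instance Definition _ x :=
  GRing.isLinear.Build R M M _ (@act R L M x) (act_linr x).

Lemma act0 x : act x 0 = 0 :> M.
Proof. exact: linear0. Qed.

End LieModuleTheory.

(* The action x . (u /\ v) = [x, u] /\ v + u /\ [x, v] of L on its exterior   *)
(* square.                                                                    *)
Section Ext2Module.
Variables (R : comNzRingType) (L : lieAlgType R).

Definition ext2_act (x : L) : ext2 L -> ext2 L :=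
  ext2_lift (fun u v => wedge (lie x u) v + wedge u (lie x v)).

Let b_linl x w :
  linear (fun u => wedge (lie x u) w + wedge u (lie x w) : ext2 L).
Proof.
move=> a u v; rewrite lie_linr !wedge_linl scalerDr !addrA; congr (_ + _).
by rewrite addrAC.
Qed.

Let b_linr x w :
  linear (fun v => wedge (lie x w) v + wedge w (lie x v) : ext2 L).
Proof.
move=> a u v; rewrite lie_linr !wedge_linr scalerDr !addrA; congr (_ + _).
by rewrite addrAC.
Qed.

Let b_alt x u : wedge (lie x u) u + wedge u (lie x u) = 0 :> ext2 L.
Proof. by rewrite wedgeC addNr. Qed.

Lemma ext2_actE x u v :
  ext2_act x (wedge u v) = wedge (lie x u) v + wedge u (lie x v).
Proof.
exact: (ext2_liftE (b_linl x) (b_linr x) (b_alt x)).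
Qed.

Lemma ext2_act_linr x : linear (ext2_act x).
Proof.
exact: (ext2_lift_linear (b_linl x) (b_linr x) (b_alt x)).
Qed.

HB.instance Definition _ x :=
  GRing.isLinear.Build R (ext2 L) (ext2 L) _ (ext2_act x) (ext2_act_linr x).

Lemma ext2_act0 x : ext2_act x 0 = 0.
Proof. exact: linear0. Qed.

Lemma ext2_actD x q r : ext2_act x (q + r) = ext2_act x q + ext2_act x r.
Proof. exact: linearD. Qed.

Lemma ext2_act_linl m : linear (ext2_act^~ m).
Proof.
move=> a x y; rewrite /ext2_act /ext2_lift /linext scaler_sumr -big_split /=.
apply: eq_bigr => p _; rewrite !scalerA [a * _]mulrC -scalerA -scalerDr.
by congr (_ *: _); rewrite !lie_linl wedge_linl wedge_linr scalerDr addrACA.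
Qed.

Let zmod_crossK (Z : zmodType) (a b c d a' d' : Z) :
  (a - a') + (d - d') = (a + b) + (c + d) - ((a' + c) + (b + d')).
Proof.
rewrite [(a + b) + _]addrACA opprD [RHS]addrACA.
by rewrite [a' + c]addrC [b + d]addrC !addrKA.
Qed.

Lemma ext2_act_lie x y m : ext2_act (lie x y) m =
  ext2_act x (ext2_act y m) - ext2_act y (ext2_act x m).
Proof.
elim/ext2_lin_ind: m => [|u v|a q r IHq IHr].
- by rewrite !ext2_act0 subrr.
- rewrite !ext2_actE !ext2_actD !ext2_actE !lie_lie wedgeBl wedgeBr.
  exact: zmod_crossK.
- by rewrite !ext2_act_linr IHq IHr scalerBr opprD addrACA.
Qed.

HB.instance Definition _ := isLieModule.Build R L (ext2 L)
  ext2_act_linl ext2_act_linr ext2_act_lie.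

End Ext2Module.

Section Cohomology.
Variables (R : comNzRingType) (L : lieAlgType R) (M : lieModType L).

Definition is_cocycle (f : L -> M) : Prop := linear f /\
  forall x y, act x (f y) - act y (f x) - f (lie x y) = 0.

Definition cocycles : {pred L -> M} := [pred f | `[< is_cocycle f >]].

Fact cocycles_submod : submod_closed cocycles.
Proof.
split=> [|a f h /asboolP[f_lin fD] /asboolP[h_lin hD]]; apply/asboolP; split.
- by move=> a x y; rewrite /= scaler0 addr0.
- by move=> x y; rewrite [0 x]/(0 : M) [0 y]/(0 : M) !act0 !subr0.
- by move=> b x y; rewrite !fctE f_lin h_lin !scalerDr !scalerA mulrC addrACA.
- move=> x y; rewrite !fctE !act_linr opprD addrACA -scalerBr opprD addrACA.
  by rewrite -scalerBr fD hD scaler0 addr0.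
Qed.

HB.instance Definition _ :=
  GRing.isSubmodClosed.Build R (L -> M) cocycles cocycles_submod.

Record Z1 : Type := MkZ1 {Z1val :> L -> M; Z1valP : Z1val \in cocycles}.

HB.instance Definition _ := [isSub for Z1val].
HB.instance Definition _ := [Choice of Z1 by <:].
HB.instance Definition _ := [SubChoice_isSubLmodule of Z1 by <:].

Fact coboundary_subproof (m : M) : (act^~ m : L -> M) \in cocycles.
Proof.
apply/asboolP; split; first exact: act_linl.
by move=> x y; rewrite act_lie subrr.
Qed.

Definition coboundary (m : M) : Z1 := MkZ1 (coboundary_subproof m).

Definition B1 : {pred Z1} := [pred f | `[< exists m, f = coboundary m >]].

Fact B1_submod : submod_closed B1.
Proof.
split=> [|a f h /asboolP[m ->] /asboolP[n ->]]; apply/asboolP.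
  by exists 0; apply/val_inj/funext => x /=; rewrite act0.
by exists (a *: m + n); apply/val_inj/funext => x /=; rewrite act_linr.
Qed.

HB.instance Definition _ := GRing.isSubmodClosed.Build R Z1 B1 B1_submod.

Definition H1 : Type := lmodquot B1.
HB.instance Definition _ := GRing.Lmodule.on H1.

Definition H1class (f : Z1) : H1 := lmodpi B1 f.

End Cohomology.

Arguments cocycles {R} L M.
Arguments Z1 {R} L M.
Arguments H1 {R} L M.

Section GoldmanAbelian.
Variables (R : realType) (g : nat).

(* The exponents (a_1, b_1, ..., a_g, b_g) of the monomials                   *)
(* x_1^a_1 y_1^b_1 ... x_g^a_g y_g^b_g.                                       *)
Definition expo : Type := {ffun 'I_g -> int * int}.
HB.instance Definition _ := GRing.Zmodule.on expo.

Definition intersection (u v : expo) : int :=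
  \sum_(j < g) ((u j).1 * (v j).2 - (v j).1 * (u j).2).

(* The monomial with exponents u is << u >>; the product of << u >> and       *)
(* << v >> is << u + v >>.                                                    *)
Definition W1 : Type := {malg R[expo]}.
HB.instance Definition _ := GRing.Lmodule.on W1.

Definition monom (u : expo) : W1 := << u >>.

Definition W1_lie (x y : W1) : W1 :=
  linext (fun u => linext (fun v => (intersection u v)%:~R *: monom (u + v)) y)
    x.

Lemma intersectionC u v : intersection u v = - intersection v u.
Proof.
by rewrite -sumrN; apply: eq_bigr => j _; rewrite opprB.
Qed.

Lemma intersectionDr u v w :
  intersection u (v + w) = intersection u v + intersection u w.
Proof.
rewrite -big_split; apply: eq_bigr => j _; rewrite !ffunE /=.
by rewrite mulrDr mulrDl opprD addrACA.
Qed.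

Lemma W1_lieE u v :
  W1_lie (monom u) (monom v) = (intersection u v)%:~R *: monom (u + v).
Proof. by rewrite /W1_lie !linextU. Qed.

Lemma W1_lie_linl y : linear (W1_lie^~ y).
Proof. exact: linext_linear. Qed.

Lemma W1_lie_linr x : linear (W1_lie x).
Proof.
move=> a y z; rewrite /W1_lie /linext scaler_sumr -big_split /=.
apply: eq_bigr => u _; rewrite [X in _ *: X]linext_linear scalerDr !scalerA.
by rewrite mulrC.
Qed.

Lemma W1_lieZDl y a x x' :
  W1_lie (a *: x + x') y = a *: W1_lie x y + W1_lie x' y.
Proof. exact: W1_lie_linl. Qed.

Lemma W1_lieZDr x a y y' :
  W1_lie x (a *: y + y') = a *: W1_lie x y + W1_lie x y'.
Proof. exact: W1_lie_linr. Qed.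

Lemma W1_lie0l y : W1_lie 0 y = 0.
Proof. exact: linear0. Qed.

Lemma W1_lie0r x : W1_lie x 0 = 0.
Proof.
by have := W1_lie_linr x (-1) 0 0; rewrite scaler0 add0r scaleN1r addNr.
Qed.

Lemma W1_lieZr a x y : W1_lie x (a *: y) = a *: W1_lie x y.
Proof. by have := W1_lie_linr x a y 0; rewrite W1_lie0r !addr0. Qed.

Lemma W1_lieC x y : W1_lie x y = - W1_lie y x.
Proof.
elim/malg_lin_ind: x => [|u|a x x' IHx IHx'].
- by rewrite W1_lie0l W1_lie0r oppr0.
- elim/malg_lin_ind: y => [|v|a y y' IHy IHy'].
  + by rewrite W1_lie0l W1_lie0r oppr0.
  + by rewrite !W1_lieE intersectionC addrC mulrNz scaleNr.
  + by rewrite W1_lie_linl W1_lie_linr IHy IHy' scalerN opprD.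
- by rewrite W1_lie_linl W1_lie_linr IHx IHx' scalerN opprD.
Qed.

Lemma W1_liexx x : W1_lie x x = 0.
Proof.
have /eqP := W1_lieC x x; rewrite -addr_eq0 -mulr2n -scaler_nat scaler_eq0.
by case/orP => [|/eqP -> //]; rewrite pnatr_eq0.
Qed.

Lemma W1_lie_jacobi x y z :
  W1_lie x (W1_lie y z) + W1_lie y (W1_lie z x) + W1_lie z (W1_lie x y) = 0.
Proof.
have lin3 (a : R) (p q r p' q' r' : W1) :
    p + q + r = 0 -> p' + q' + r' = 0 ->
    (a *: p + p') + (a *: q + q') + (a *: r + r') = 0.
  move=> pqr pqr'; rewrite [a *: p + p' + _]addrACA [LHS]addrACA -!scalerDr.
  by rewrite pqr pqr' scaler0 addr0.
elim/malg_lin_ind: x => [|u|a x x' IHx IHx'].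
- by rewrite !(W1_lie0l, W1_lie0r) !addr0.
- elim/malg_lin_ind: y => [|v|a y y' IHy IHy'].
  + by rewrite !(W1_lie0l, W1_lie0r) !addr0.
  + elim/malg_lin_ind: z => [|w|a z z' IHz IHz'].
    * by rewrite !(W1_lie0l, W1_lie0r) !addr0.
    * rewrite !W1_lieE !W1_lieZr !W1_lieE !scalerA -!intrM.
      have -> : v + (w + u) = u + (v + w) by rewrite addrA addrC.
      have -> : w + (u + v) = u + (v + w) by rewrite addrC -addrA.
      rewrite -!scalerDl -!intrD !intersectionDr (intersectionC v u).
      rewrite (intersectionC w u) (intersectionC w v).
      by rewrite [X in X%:~R](_ : _ = 0) ?scale0r //; ring.
    * by rewrite !(W1_lieZDl _ a z z') !W1_lieZDr; exact: lin3.
  + by rewrite !(W1_lieZDl _ a y y') !W1_lieZDr; exact: lin3.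
- by rewrite !(W1_lieZDl _ a x x') !W1_lieZDr; exact: lin3.
Qed.

HB.instance Definition _ := isLieAlgebra.Build R W1
  W1_lie_linl W1_lie_linr W1_liexx W1_lie_jacobi.

(* Hom(Z^2g, R), with pointwise operations; R^o is R as a module over itself. *)
Definition hom_expo_pred : {pred expo -> R^o} :=
  [pred k | `[< zmod_morphism k >]].

Fact hom_expo_submod : submod_closed hom_expo_pred.
Proof.
split=> [|a k l /asboolP kB /asboolP lB]; apply/asboolP => u v.
  by rewrite subr0.
by rewrite !fctE kB lB scalerBr opprD addrACA.
Qed.

HB.instance Definition _ :=
  GRing.isSubmodClosed.Build R (expo -> R^o) hom_expo_pred hom_expo_submod.

Record hom_expo : Type := HomExpo
  {hom_expo_val :> expo -> R^o; _ : hom_expo_val \in hom_expo_pred}.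

HB.instance Definition _ := [isSub for hom_expo_val].
HB.instance Definition _ := [Choice of hom_expo by <:].
HB.instance Definition _ := [SubChoice_isSubLmodule of hom_expo by <:].

(* monom 0 is the unit 1 of the group algebra. *)
Definition Delta (k : hom_expo) : W1 -> ext2 W1 :=
  linext (fun u => (k u : R) *: wedge (monom u) (monom 0)).

End GoldmanAbelian.

(* Main.v *)
From HB Require Import structures.
Require Import Defs.
From mathcomp Require Import all_boot all_order all_algebra.
From mathcomp Require Import finmap boolp functions reals monalg ring lra zify.
Set Implicit Arguments.
Unset Strict Implicit.
Unset Printing Implicit Defensive.
Import Order.TTheory GRing.Theory Num.Theory.
Local Open Scope ring_scope.

(* Write A = Z^2g, om for the intersection form, and a tensor in the exterior *)
(* square as an antisymmetric, finitely supported function on A * A. Fix      *)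
(* u = x_1 and give (a, b) the weights al = om u a, be = om u b. If t and s are   *)
(* the translations by u in the two factors, the monomial u^k acts as         *)
(* k (al t^k + be s^k), which is injective unless al = be = 0.                *)
(*   On the weights with al + be <> 0, the polynomials al t + be s and        *)
(* al t^2 + be s^2 generate the unit ideal, so a cocycle F agrees there with  *)
(* a coboundary at u. For al + be = 0 the obstruction is the value of F u in  *)
(* the cokernel of t - s, i.e. its sums along antidiagonals. The cocycle      *)
(* identity makes these sums proportional to al, so they vanish because the   *)
(* support is finite. After subtracting a coboundary, F u^k is supported on   *)
(* the orthogonal of u, for all k.                                            *)
(*   Then, for om u v <> 0, F v is supported on the weights (om u v, 0) and   *)
(* (0, om u v). Comparing different v shows that F v is, up to a second       *)
(* coboundary, a multiple K v of v /\ 1. These v and the central element 1    *)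
(* generate W_1(g), and F 1 = 0 because F 1 is invariant; so F v is K v times *)
(* v /\ 1 for all v, and the cocycle identity says that K is additive.        *)

(** Surjectivity rests on [cocycle2_normal_form]: an antisymmetric cocycle on monomials is a
    coboundary plus [K v *: wedge1 v] with [K] additive. The first coboundary comes from
    [ex_antisym_potential], by way of [antidiag_sum0]; the second from [ex_perp_potential], by way
    of [supp_off_axis] and [perp_part_prop]; [cocycle2_0] and [cocycle2_additive] finish.
    Injectivity is elementary: as om v v = om v 0 = 0, the value of a coboundary at v has no
    component on v /\ 1 ([tact_wedge1_eq0]). Since 2 is invertible, sending x /\ y to (x tensor y) -
    (y tensor x) identifies the exterior square with the antisymmetric tensors ([ext2_tensor_inj],
    [ext2_tensor_onto]), and by bilinearity the cocycle identity need only be tested on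
    monomials. *)

Inductive zmod_expr :=
| ZmodZero | ZmodVar of nat | ZmodAdd of zmod_expr & zmod_expr
| ZmodOpp of zmod_expr.

Fixpoint zmod_eval (V : zmodType) (env : seq V) e : V :=
  match e with
  | ZmodZero => 0
  | ZmodVar n => env`_n
  | ZmodAdd e1 e2 => zmod_eval env e1 + zmod_eval env e2
  | ZmodOpp e1 => - zmod_eval env e1
  end.

Fixpoint zmod_coef e (i : nat) : int :=
  match e with
  | ZmodZero => 0
  | ZmodVar n => (i == n)%:Z
  | ZmodAdd e1 e2 => zmod_coef e1 i + zmod_coef e2 i
  | ZmodOpp e1 => - zmod_coef e1 i
  end.

Lemma zmod_evalE (V : zmodType) (env : seq V) e :
  zmod_eval env e = \sum_(i < size env) env`_i *~ zmod_coef e i.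
Proof.
elim: e => [|n|e1 IH1 e2 IH2|e1 IH1] /=.
- by rewrite big1.
- case: (ltnP n (size env)) => ln; last first.
    rewrite nth_default // big1 // => i _; case: eqVneq => // ein.
    by move: (ltn_ord i); rewrite ein ltnNge ln.
  rewrite (bigD1 (Ordinal ln)) //= eqxx mulr1z big1 ?addr0 // => i ni.
  by rewrite -[_ == n]/(i == Ordinal ln) (negPf ni) mulr0z.
- rewrite IH1 IH2 -big_split; apply: eq_bigr => i _ /=.
  by rewrite mulrzDr.
- by rewrite IH1 -sumrN; apply: eq_bigr => i _; rewrite mulrNz.
Qed.

Lemma zmod_eval_eq (V : zmodType) (env : seq V) e1 e2 :
  all (fun i => zmod_coef e1 i == zmod_coef e2 i) (iota 0 (size env)) ->
  zmod_eval env e1 = zmod_eval env e2.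
Proof.
move=> /allP ce; rewrite !zmod_evalE; apply: eq_bigr => i _.
by congr (_ *~ _); apply/eqP/ce; rewrite mem_iota /=.
Qed.

Ltac zmod_index x l :=
  match l with
  | ?y :: _ => let _ := match goal with _ => unify x y end in constr:(0%N)
  | _ :: ?l' => let n := zmod_index x l' in constr:(n.+1)
  end.
Ltac zmod_insert x l :=
  match l with
  | _ => let _ := zmod_index x l in l
  | _ => constr:(x :: l)
  end.
Ltac zmod_atoms e l :=
  lazymatch e with
  | 0%R => l
  | (?e1 + ?e2)%R => let l1 := zmod_atoms e1 l in zmod_atoms e2 l1
  | (- ?e1)%R => zmod_atoms e1 l
  | _ => zmod_insert e l
  end.
Ltac zmod_reify e l :=
  lazymatch e with
  | 0%R => constr:(ZmodZero)
  | (?e1 + ?e2)%R => let r1 := zmod_reify e1 l in let r2 := zmod_reify e2 l in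
      constr:(ZmodAdd r1 r2)
  | (- ?e1)%R => let r1 := zmod_reify e1 l in constr:(ZmodOpp r1)
  | _ => let n := zmod_index e l in constr:(ZmodVar n)
  end.
Ltac zmodule :=
  lazymatch goal with
  | |- @eq ?V ?x ?y =>
    let l0 := zmod_atoms x (@nil V) in
    let l := zmod_atoms y l0 in
    let ex := zmod_reify x l in let ey := zmod_reify y l in
    apply: (@zmod_eval_eq _ l ex ey); vm_compute; reflexivity
  end.

(** * Finitely supported sequences *)

Lemma ex_bound (T : eqType) (s : seq T) (f : T -> nat) :
  exists N, forall k, k \in s -> (f k < N)%N.
Proof.
exists (\max_(k <- s) f k).+1 => k ks; rewrite ltnS.
exact: (leq_bigmax_seq (F := f) k).
Qed.

(** Laurent polynomials over a domain form a domain. Concretely, the first nonzero coefficient makes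
    each term depend on later ones, so vanishing spreads downwards from [N]. *)
Lemma finsupp_rec2 (R : idomainType) (x : int -> R) (N : nat) (c0 c1 c2 : R) :
  (forall i, (N <= `|i|)%N -> x i = 0) ->
  (forall i, c0 * x i + c1 * x (i + 1) + c2 * x (i + 2) = 0) ->
  [|| c0 != 0, c1 != 0 | c2 != 0] -> forall i, x i = 0.
Proof.
move=> xN.
have rec1 (c d e : R) : c != 0 ->
    (forall i, c * x i + d * x (i + 1) + e * x (i + 2) = 0) ->
    forall i, x i = 0.
  move=> c0n xrec.
  have down (n : nat) (i : int) : N%:Z - n%:Z <= i -> x i = 0.
    elim/ltn_ind: n i => -[|n] IH i le_i; first by apply: xN; lia.
    case: n IH le_i => [|n] IH le_i.
      case: (ltrP i N) => lt_i; last by apply: xN; lia.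
      have := xrec i; rewrite (xN (i + 1)) ?(xN (i + 2)); try by lia.
      by rewrite !mulr0 !addr0 => /eqP; rewrite mulf_eq0 (negPf c0n) => /eqP.
    have := xrec i; rewrite (IH n.+1 _ (i + 1)) ?(IH n _ (i + 2)); try by lia.
    by rewrite !mulr0 !addr0 => /eqP; rewrite mulf_eq0 (negPf c0n) => /eqP.
  by move=> i; apply: (down (N + `|i|)%N); lia.
move=> xrec; case: (eqVneq c0 0) => [c00|c0n _]; last exact: (rec1 c0 c1 c2).
case: (eqVneq c1 0) => [c10 /= c2n|c1n _ i].
  move=> i; have := xrec (i - 2); rewrite subrK c00 c10 !mul0r !add0r => /eqP.
  by rewrite mulf_eq0 (negPf c2n) => /eqP.
apply: (rec1 c1 c2 0) => // j; have := xrec (j - 1).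
have -> : j - 1 + 2 = j + 1 by lia.
by rewrite subrK c00 mul0r mul0r add0r addr0.
Qed.

(* Locked, so that unification never compares tensors by unfolding them. *)
HB.lock Definition cf (R : realFieldType) (A : zmodType)
  (phi : {malg R[(A * A)%type]}) (a b : A) : R := phi@_(a, b).

HB.lock Definition shift (R : realFieldType) (A : zmodType) (x y : A)
    (phi : {malg R[(A * A)%type]}) : {malg R[(A * A)%type]} :=
  linext (fun k => << (k.1 + x, k.2 + y) >>) phi.

HB.lock Definition swap (R : realFieldType) (A : zmodType)
    (phi : {malg R[(A * A)%type]}) : {malg R[(A * A)%type]} :=
  linext (fun k => << (k.2, k.1) >>) phi.

HB.lock Definition tact (R : realFieldType) (A : zmodType)
    (om : A -> A -> int) (x : A)
    (phi : {malg R[(A * A)%type]}) : {malg R[(A * A)%type]} :=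
  linext (fun k => (om x k.1)%:~R *: << (k.1 + x, k.2) >> +
    (om x k.2)%:~R *: << (k.1, k.2 + x) >>) phi.

HB.lock Definition pairing (R : realFieldType) (A : zmodType)
    (wt : A -> A -> R) (phi : {malg R[(A * A)%type]}) : R^o :=
  linext (fun k => (wt k.1 k.2 : R^o)) phi.

(** * Tensors over an abelian group with an alternating integral form *)

Section TensorSquare.
Variables (R : realFieldType) (A : zmodType) (om : A -> A -> int).
Hypothesis omDr : forall x y z, om x (y + z) = om x y + om x z.
Hypothesis omC : forall x y, om x y = - om y x.

Local Notation T := {malg R[(A * A)%type]}.
Local Notation W x y := ((om x y)%:~R : R).
Implicit Types (x y z u v w a b p q : A) (phi psi : T).

Lemma WC x y : W x y = - W y x.
Proof. by rewrite omC rmorphN. Qed.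

Lemma WDr x y z : W x (y + z) = W x y + W x z.
Proof. by rewrite omDr rmorphD. Qed.

Lemma WDl x y z : W (x + y) z = W x z + W y z.
Proof. by rewrite (WC (x + y)) WDr (WC x) (WC y) opprD. Qed.

Lemma W0r x : W x 0 = 0.
Proof. by have := WDr x 0 0; rewrite addr0 => ?; lra. Qed.

Lemma W0l x : W 0 x = 0.
Proof. by rewrite WC W0r oppr0. Qed.

Lemma WNr x y : W x (- y) = - W x y.
Proof. by apply/eqP; rewrite -addr_eq0 -WDr addNr W0r. Qed.

Lemma WNl x y : W (- x) y = - W x y.
Proof. by rewrite (WC (- x)) WNr (WC x). Qed.

Lemma Wxx x : W x x = 0.
Proof. by have := WC x x; lra. Qed.

Lemma WMnr x y n : W x (y *+ n) = n%:R * W x y.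
Proof.
by elim: n => [|n IH]; rewrite ?mulr0n ?W0r ?mul0r // mulrS WDr IH; ring.
Qed.

Lemma WMzr x y k : W x (y *~ k) = k%:~R * W x y.
Proof.
case: k => n; first exact: WMnr.
by rewrite NegzE mulrNz WNr -[(y *~ _)]/(y *+ n.+1) WMnr rmorphN /=; ring.
Qed.

Lemma WMzl x y k : W (y *~ k) x = k%:~R * W y x.
Proof. by rewrite (WC (y *~ k)) WMzr (WC y); ring. Qed.

Definition Wlin := (WDr, WDl, WNr, WNl, W0r, W0l, Wxx, WMzr, WMzl).

Lemma cfD phi psi a b : cf (phi + psi) a b = cf phi a b + cf psi a b.
Proof. rewrite cf.unlock; exact: mcoeffD. Qed.

Lemma cfN phi a b : cf (- phi) a b = - cf phi a b.
Proof. rewrite cf.unlock; exact: mcoeffN. Qed.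

Lemma cfZ r phi a b : cf (r *: phi) a b = r * cf phi a b.
Proof. rewrite cf.unlock; exact: mcoeffZ. Qed.

Lemma cf0 a b : cf (0 : T) a b = 0.
Proof. rewrite cf.unlock; exact: mcoeff0. Qed.

Lemma cfU k a b : cf (<< k >> : T) a b = (k == (a, b))%:R.
Proof. rewrite cf.unlock; exact: mcoeffU. Qed.

Lemma cfP phi psi : (forall a b, cf phi a b = cf psi a b) -> phi = psi.
Proof. by move=> e; apply/malgP => -[a b]; have := e a b; rewrite cf.unlock. Qed.

Lemma cf_neq0 phi a b : (cf phi a b != 0) = ((a, b) \in msupp phi).
Proof. rewrite cf.unlock; exact: mcoeff_neq0. Qed.

Definition cfE := (cfD, cfN, cfZ, cf0).

Fact shift_linear x y : linear (shift x y : T -> T).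
Proof. by rewrite shift.unlock; exact: linext_linear. Qed.
HB.instance Definition _ x y :=
  GRing.isLinear.Build R T T _ (shift x y) (shift_linear x y).

Fact swap_linear : linear (@swap R A).
Proof. by rewrite swap.unlock; exact: linext_linear. Qed.
HB.instance Definition _ :=
  GRing.isLinear.Build R T T _ (@swap R A) swap_linear.

Fact tact_linear x : linear (tact om x : T -> T).
Proof. by rewrite tact.unlock; exact: linext_linear. Qed.
HB.instance Definition _ x :=
  GRing.isLinear.Build R T T _ (tact om x) (tact_linear x).

Lemma pairing_linear wt r phi psi :
  pairing wt (r *: phi + psi) = r * pairing wt phi + pairing wt psi.
Proof. by rewrite pairing.unlock; exact: linext_linear. Qed.

Lemma pairing0 wt : pairing wt (0 : T) = 0.
Proof. by rewrite pairing.unlock linear0. Qed.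

Lemma shiftU x y a b : shift x y << (a, b) >> = << (a + x, b + y) >> :> T.
Proof. by rewrite shift.unlock linextU. Qed.

Lemma swapU a b : swap << (a, b) >> = << (b, a) >> :> T.
Proof. by rewrite swap.unlock linextU. Qed.

Lemma tactU x a b : tact om x << (a, b) >> =
  W x a *: << (a + x, b) >> + W x b *: << (a, b + x) >> :> T.
Proof. by rewrite tact.unlock linextU. Qed.

Lemma pairingU wt a b : pairing wt (<< (a, b) >> : T) = wt a b.
Proof. by rewrite pairing.unlock linextU. Qed.

Lemma shiftE x y phi a b : cf (shift x y phi) a b = cf phi (a - x) (b - y).
Proof.
elim/malg_lin_ind: phi => [|[c d]|r phi psi IH1 IH2].
- by rewrite linear0 !cf0.
- rewrite shiftU !cfU /= !xpair_eqE.
  rewrite -[c == a - x](inj_eq (addIr x)) -[d == b - y](inj_eq (addIr y)).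
  by rewrite !subrK.
- by rewrite linearP !cfE IH1 IH2.
Qed.

Lemma swapE phi a b : cf (swap phi) a b = cf phi b a.
Proof.
elim/malg_lin_ind: phi => [|[c d]|r phi psi IH1 IH2].
- by rewrite linear0 !cf0.
- by rewrite swapU !cfU /= !xpair_eqE andbC.
- by rewrite linearP !cfE IH1 IH2.
Qed.

(** The weights may be read at the target (a, b) because om x x = 0: translation by [x] preserves
    them. *)
Lemma tactE x phi a b : cf (tact om x phi) a b =
  W x a * cf phi (a - x) b + W x b * cf phi a (b - x).
Proof.
elim/malg_lin_ind: phi => [|[c d]|r phi psi IH1 IH2].
- by rewrite linear0 !cf0; ring.
- rewrite tactU !cfE !cfU /= !xpair_eqE.
  rewrite -[c == a - x](inj_eq (addIr x)) -[d == b - x](inj_eq (addIr x)) !subrK.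
  congr (_ + _).
    by case: (eqVneq (c + x) a) => [<-|] /=; rewrite ?mulr0 // !Wlin addr0.
  case: (eqVneq (d + x) b) => [<-|]; rewrite ?andbF ?mulr0 //.
  by rewrite !Wlin addr0.
- by rewrite linearP !cfE IH1 IH2; ring.
Qed.

Lemma tact_lie x y phi :
  tact om x (tact om y phi) - tact om y (tact om x phi) =
  W x y *: tact om (x + y) phi.
Proof.
apply: cfP => a b; rewrite !cfE !tactE !Wlin.
have e c : c - y - x = c - x - y by rewrite addrAC.
have f c : c - (x + y) = c - x - y by rewrite opprD addrA.
by rewrite !e !f (WC y x); ring.
Qed.

Lemma malg_of_fun (s : seq (A * A)) (f : A -> A -> R) :
  (forall a b, f a b != 0 -> (a, b) \in s) ->
  exists phi : T, forall a b, cf phi a b = f a b.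
Proof.
move=> fs; exists (\sum_(k <- undup s) f k.1 k.2 *: << k >>) => a b.
pose g k : R := f k.1 k.2 * (k == (a, b))%:R.
have -> (t : seq (A * A)) :
    cf (\sum_(k <- t) f k.1 k.2 *: << k >>) a b = \sum_(k <- t) g k.
  by elim: t => [|k t IH]; rewrite ?big_nil ?cf0 // !big_cons !cfE cfU IH.
case: (boolP ((a, b) \in undup s)) => abs.
  rewrite (bigD1_seq (a, b)) ?undup_uniq //= /g eqxx mulr1.
  by rewrite big1 ?addr0 // => k nk; rewrite (negPf nk) mulr0.
rewrite big_seq big1 => [|k ks].
  by apply/esym/eqP; apply: contraNT abs; rewrite mem_undup; exact: fs.
rewrite /g; case: eqVneq => [kab|]; rewrite ?mulr0 //.
by rewrite -kab ks in abs.
Qed.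

Lemma pairingE wt phi :
  pairing wt phi = \sum_(k <- msupp phi) cf phi k.1 k.2 * wt k.1 k.2.
Proof. by rewrite pairing.unlock cf.unlock; apply: eq_bigr => -[a b] _. Qed.

Lemma pairing_delta a b phi :
  pairing (fun x y => ((x, y) == (a, b))%:R) phi = cf phi a b.
Proof.
elim/malg_lin_ind: phi => [|[c d]|r phi psi IH1 IH2].
- by rewrite pairing0 cf0.
- by rewrite pairingU cfU.
- by rewrite pairing_linear !cfE IH1 IH2.
Qed.

Lemma pairing_shift wt x y phi :
  pairing wt (shift x y phi) = pairing (fun a b => wt (a + x) (b + y)) phi.
Proof.
elim/malg_lin_ind: phi => [|[a b]|r phi psi IH1 IH2].
- by rewrite linear0 !pairing0.
- by rewrite shiftU !pairingU.
- by rewrite linearP !pairing_linear IH1 IH2.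
Qed.

Lemma pairing_tact wt x phi : pairing wt (tact om x phi) =
  pairing (fun a b => W x a * wt (a + x) b + W x b * wt a (b + x)) phi.
Proof.
elim/malg_lin_ind: phi => [|[a b]|r phi psi IH1 IH2].
- by rewrite linear0 !pairing0.
- rewrite tactU -[_ *: << (a, _) >>]addr0 !pairing_linear pairing0.
  by rewrite !pairingU addr0.
- by rewrite linearP !pairing_linear IH1 IH2.
Qed.

Lemma pairingD (w1 w2 : A -> A -> R) phi :
  pairing (fun a b => w1 a b + w2 a b) phi = pairing w1 phi + pairing w2 phi.
Proof.
by rewrite !pairingE -big_split; apply: eq_bigr => k _; rewrite mulrDr.
Qed.

Lemma pairingZ c wt phi :
  pairing (fun a b => c * wt a b) phi = c * pairing wt phi.
Proof.
by rewrite !pairingE mulr_sumr; apply: eq_bigr => k _; rewrite mulrCA.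
Qed.

Lemma eq_pairing (w1 w2 : A -> A -> R) phi :
  (forall a b, w1 a b * cf phi a b = w2 a b * cf phi a b) ->
  pairing w1 phi = pairing w2 phi.
Proof.
by move=> e; rewrite !pairingE; apply: eq_bigr => k _; rewrite mulrC e mulrC.
Qed.

Lemma pairing_eq0 wt phi :
  (forall a b, wt a b * cf phi a b = 0) -> pairing wt phi = 0.
Proof. by move=> e; rewrite pairingE big1 // => k _; rewrite mulrC e. Qed.

Lemma eq_pairingr wt phi psi :
  (forall a b, wt a b * cf phi a b = wt a b * cf psi a b) ->
  pairing wt phi = pairing wt psi.
Proof.
move=> e; apply/eqP; rewrite -subr_eq0 -[- _]mulN1r addrC -pairing_linear.
by apply/eqP/pairing_eq0 => a b; rewrite !cfE mulrDr e; ring.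
Qed.

Lemma pairing_neq0 wt phi :
  pairing wt phi != 0 -> exists a b, wt a b * cf phi a b != 0.
Proof.
move=> nz; apply: contrapT => none; move/eqP: nz; apply.
apply: pairing_eq0 => a b; case: (eqVneq (wt a b * cf phi a b) 0) => // abn.
by case: none; exists a, b.
Qed.

Definition is_cocycle2 (F : A -> T) : Prop := forall v w,
  tact om v (F w) - tact om w (F v) = W v w *: F (v + w).

Lemma cocycle2E F : is_cocycle2 F -> forall v w a b,
  W v w * cf (F (v + w)) a b =
  W v a * cf (F w) (a - v) b + W v b * cf (F w) a (b - v) -
  (W w a * cf (F v) (a - w) b + W w b * cf (F v) a (b - w)).
Proof. by move=> Fc v w a b; rewrite -cfZ -Fc !cfE !tactE. Qed.

Lemma cocycle2B_tact F mu :
  is_cocycle2 F -> is_cocycle2 (fun v => F v - tact om v mu).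
Proof.
move=> Fc v w; rewrite !linearB /= -Fc -tact_lie.
by rewrite opprB addrACA [_ - tact om w _]addrC -!addrA [LHS]addrC; zmodule.
Qed.

Lemma pairing_cocycle2 F : is_cocycle2 F -> forall (wt : A -> A -> R) v w,
  W v w * pairing wt (F (v + w)) =
  pairing wt (tact om v (F w)) - pairing wt (tact om w (F v)).
Proof.
move=> Fc wt v w.
have := pairing_linear wt (W v w) (F (v + w)) 0; rewrite pairing0 !addr0 => <-.
by rewrite -Fc addrC -scaleN1r pairing_linear mulN1r addrC.
Qed.

(** * Lines in the direction [u], and injectivity of its action *)

Variables u v0 : A.
Hypothesis uv0 : om u v0 = 1.

Lemma Wuv0 : W u v0 = 1.
Proof. by rewrite uv0. Qed.

Lemma om_line a (i : int) : om (a + u *~ i) v0 = om a v0 + i.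
Proof.
by apply: (@intr_inj R); rewrite WDl WMzl Wuv0 mulr1 rmorphD.
Qed.

Lemma mulrz2 x : x *~ 2 = x + x.
Proof. exact: mulr2n. Qed.

(** Pairing with [v0] is a coordinate along [u], so a line meets a finite support in a bounded
    range. *)
Lemma line_bound phi a b : exists N : nat, forall i : int,
  (N <= `|i|)%N -> cf phi (a + u *~ i) (b - u *~ i) = 0.
Proof.
have [N Nb] := ex_bound (msupp phi) (fun k : A * A => `|om k.1 v0|%N).
exists (N + `|om a v0|)%N => i iN; apply/eqP; apply: contraTT iN.
by rewrite cf_neq0 => /Nb /=; rewrite om_line; lia.
Qed.

(** The weights are constant along the line, so the coefficients there form a finitely supported
    solution of a recurrence with constant coefficients. *)
Lemma line_inj phi (al be c0 c1 c2 : R) :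
  (forall a b, W u a = al -> W u b = be ->
     c0 * cf phi a b + c1 * cf phi (a + u) (b - u) +
     c2 * cf phi (a + u + u) (b - u - u) = 0) ->
  [|| c0 != 0, c1 != 0 | c2 != 0] ->
  forall a b, W u a = al -> W u b = be -> cf phi a b = 0.
Proof.
move=> rec cn a b ua ub; have [N Nb] := line_bound phi a b.
have := finsupp_rec2 Nb (c0 := c0) (c1 := c1) (c2 := c2) _ cn 0.
rewrite mulr0z subr0 addr0; apply => i.
have := rec (a + u *~ i) (b - u *~ i); rewrite !Wlin ua ub mulr0 subr0 addr0.
move=> /(_ erefl erefl) <-; rewrite !mulrzDr mulr1z.
by rewrite !opprD !addrA.
Qed.

Lemma tact_inj phi a b :
  (forall a' b', W u a' = W u a -> W u b' = W u b ->
     cf (tact om u phi) a' b' = 0) ->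
  (W u a != 0) || (W u b != 0) -> cf phi a b = 0.
Proof.
move=> tz nz; apply: (@line_inj phi (W u a) (W u b) (W u a) (W u b) 0) => //.
  move=> a' b' ua ub; have := tz (a' + u) b'.
  rewrite tactE !Wlin addr0 ua ub addrK => e.
  by rewrite mul0r addr0 e.
by rewrite eqxx /= orbF.
Qed.

(** Powers of [u] commute, so the cocycle identity reduces to u . F(u^k) = u^k . F(u). *)
Lemma cocycle2_line F k a b : is_cocycle2 F ->
  W u a * cf (F (u *~ k)) (a - u) b + W u b * cf (F (u *~ k)) a (b - u) =
  k%:~R * (W u a * cf (F u) (a - u *~ k) b + W u b * cf (F u) a (b - u *~ k)).
Proof.
move=> /cocycle2E /(_ u (u *~ k) a b); rewrite !Wlin mulr0 mul0r => /esym/eqP.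
by rewrite subr_eq0 => /eqP ->; ring.
Qed.

Lemma cocycle2_perp F : is_cocycle2 F ->
  (forall a b, (W u a != 0) || (W u b != 0) -> cf (F u) a b = 0) ->
  forall k a b, (W u a != 0) || (W u b != 0) -> cf (F (u *~ k)) a b = 0.
Proof.
move=> Fc Fu k a b nz; apply: tact_inj (nz) => a' b' ua ub.
rewrite tactE cocycle2_line // !Fu ?mulr0 ?addr0 ?mulr0 // !Wlin mulr0 subr0.
  by rewrite ua ub.
by rewrite ua ub.
Qed.

(** For opposite weights [cocycle2_line] reads al (t - s) F(u^2) = 2 al (t^2 - s^2) F(u), and al (t
    - s) can be cancelled by [tact_inj]. *)
Lemma cocycle2_double F a b : is_cocycle2 F ->
  W u b = - W u a -> W u a != 0 ->
  cf (F (u + u)) a b = 2 * (cf (F u) (a - u) b + cf (F u) a (b - u)).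
Proof.
move=> Fc uab nz; apply/eqP; rewrite -subr_eq0; apply/eqP.
set phi := F (u + u) - 2 *: (shift u 0 (F u) + shift 0 u (F u)).
have phiE c d : cf phi c d =
    cf (F (u + u)) c d - 2 * (cf (F u) (c - u) d + cf (F u) c (d - u)).
  by rewrite /phi !cfE !shiftE !subr0.
rewrite -phiE; apply: tact_inj; last by rewrite nz.
move=> a' b' ua ub; have := cocycle2_line 2 a' b' Fc.
rewrite mulrz2 tactE !phiE ub ua uab !opprD !addrA.
set X := cf _ _ _; set Y := cf _ _ _; set Z := cf _ _ _; set Z' := cf _ _ _.
by move=> e; lra.
Qed.

(** * Sums along antidiagonals *)

(** Pairing with this indicator sums a tensor along an orbit of t s^-1, and so kills the image of t
    - s. *)
Definition antidiag (a1 e a b : A) : R :=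
  (`[< (exists j : int, a = a1 + u *~ j) /\ a + b = e >])%:R.

Lemma antidiag_shift a1 e x y a b :
  antidiag a1 e (a + x) (b + y) = antidiag (a1 - x) (e - x - y) a b.
Proof.
rewrite /antidiag; congr (_%:R); congr (nat_of_bool _).
apply: asbool_equiv_eq; split=> -[[j ej] es]; split.
- by exists j; rewrite -[a](addrK x) ej addrAC.
- by rewrite -es; zmodule.
- by exists j; rewrite ej addrAC subrK.
- by rewrite addrACA es; zmodule.
Qed.

Lemma antidiag_line a1 e a b : antidiag (a1 - u) e a b = antidiag a1 e a b.
Proof.
rewrite /antidiag; congr (_%:R); congr (nat_of_bool _).
apply: asbool_equiv_eq; split=> -[[j ->] es]; split => //.
  by exists (j - 1); rewrite mulrzBr mulr1z; zmodule.
by exists (j + 1); rewrite mulrzDr mulr1z; zmodule.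
Qed.

Lemma antidiag_shiftl a1 e x a b :
  antidiag a1 e (a + x) b = antidiag (a1 - x) (e - x) a b.
Proof. by rewrite -{1}[b]addr0 antidiag_shift subr0. Qed.

Lemma antidiag_shiftr a1 e x a b :
  antidiag a1 e a (b + x) = antidiag a1 (e - x) a b.
Proof. by rewrite -{1}[a]addr0 antidiag_shift !subr0. Qed.

(** Both weights are constant on an antidiagonal, so factors depending only on them may be evaluated
    there. *)
Lemma antidiag_eq a1 e a b (c c' : R) :
  (W u a = W u a1 -> W u b = W u e - W u a1 -> c = c') ->
  c * antidiag a1 e a b = c' * antidiag a1 e a b.
Proof.
rewrite /antidiag; case: asboolP => [[[j ->] <-]|]; last by rewrite !mulr0.
rewrite !Wlin !mulr0 !addr0 => -> //.
by rewrite addrAC subrr add0r.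
Qed.

(* Pairing with an antidiagonal is, up to normalization, the projection onto  *)
(* the cokernel of the action of [u]; it intertwines that action with the     *)
(* translation of the antidiagonals.                                          *)
Lemma pairing_antidiag_tact k a1 e phi :
  pairing (antidiag a1 (e + u *~ k)) (tact om (u *~ k) phi) =
  k%:~R * W u e * pairing (antidiag a1 e) phi.
Proof.
rewrite pairing_tact -pairingZ; apply: eq_pairing => a b.
congr (_ * _); rewrite antidiag_shiftl antidiag_shiftr addrK.
have -> : antidiag (a1 - u *~ k) e a b = antidiag a1 e a b.
  rewrite /antidiag; congr (_%:R); congr (nat_of_bool _).
  apply: asbool_equiv_eq; split=> -[[j ->] es]; split => //.
    by exists (j - k); rewrite mulrzBr; zmodule.
  by exists (j + k); rewrite mulrzDr; zmodule.
rewrite -mulrDl; apply: antidiag_eq => ua ub.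
by rewrite !Wlin ua ub; ring.
Qed.

(** The condition on [e] gives the bracket and the action of u^k the same factor k om u v, which
    turns their sums into a difference. *)
Lemma cocycle2_antidiag F a1 e v k : is_cocycle2 F -> W u e = W u v ->
  k%:~R * W u v * (pairing (antidiag a1 (e + u *~ k)) (F (v + u *~ k)) -
                   pairing (antidiag a1 e) (F v)) =
  - pairing (fun a b => W v a * antidiag (a1 - v) (e + u *~ k - v) a b +
                        W v b * antidiag a1 (e + u *~ k - v) a b) (F (u *~ k)).
Proof.
move=> Fc uev.
have := pairing_cocycle2 Fc (antidiag a1 (e + u *~ k)) (u *~ k) v.
rewrite pairing_antidiag_tact uev pairing_tact [u *~ k + v]addrC !Wlin mulrBr.
move=> ->; rewrite addrAC subrr add0r; congr (- _); apply: eq_pairing => a b.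
by rewrite antidiag_shiftl antidiag_shiftr.
Qed.

(* The cocycle identity for the pairs [(u, v)], [(u, v + u)] and [(2 u, v)]    *)
(* computes the same second difference in two ways.                           *)
Lemma antidiag_relation F a1 d v : is_cocycle2 F ->
  W u d = 0 -> W u v != 0 -> W u a1 != 0 -> W u a1 - W u v != 0 ->
  W u a1 * pairing (antidiag (a1 - v) (u + d)) (F u) +
  (W u v - W u a1) * pairing (antidiag a1 (u + d)) (F u) = 0.
Proof.
move=> Fc ud uv ua uav; have [e eE] : exists e, e = v + d by exists (v + d).
have [t tE] : exists t, t = u + d by exists (u + d).
have ue : W u e = W u v by rewrite eE !Wlin ud addr0.
have ut : W u t = 0 by rewrite tE !Wlin ud addr0.
rewrite -tE.
pose P := antidiag (a1 - v) t; pose Q := antidiag a1 t.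
(* The integrand left by the action of [v + c u] on F u. *)
pose f (c : R) (a b : A) :=
  (W v a + c * W u a) * P a b + (W v b + c * W u b) * Q a b.
pose Y0 := pairing (antidiag a1 e) (F v).
pose Y1 := pairing (antidiag a1 (e + u)) (F (v + u)).
pose Y2 := pairing (antidiag a1 (e + u + u)) (F (v + u + u)).
have E1 : W u v * (Y1 - Y0) = - pairing (f 0) (F u).
  have := cocycle2_antidiag a1 1 Fc ue; rewrite !mulr1z mul1r => ->.
  congr (- _); apply: eq_pairing => a b; rewrite /f !mul0r !addr0 /P /Q.
  by have -> : e + u - v = t by rewrite eE tE; zmodule.
have E2 : W u v * (Y2 - Y1) = - pairing (f 1) (F u).
  have uevu : W u (e + u) = W u (v + u) by rewrite !Wlin ue.
  have := cocycle2_antidiag a1 1 Fc uevu.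
  rewrite !mulr1z mul1r WDr Wxx addr0 -/Y1 -/Y2 => ->.
  congr (- _); apply: eq_pairing => a b; rewrite /f !mul1r /P /Q.
  have -> : e + u + u - (v + u) = t by rewrite eE tE; zmodule.
  by rewrite opprD addrA antidiag_line !WDl.
(* Here F(u^2) is replaced by 2 (t + s) F(u) using [cocycle2_double]. Its first weight is om u a1 -
   om u v on one antidiagonal and om u a1 on the other, whence the two nonvanishing hypotheses. *)
have E3 : 2 * W u v * (Y2 - Y0) = - (2 * (pairing (f 0) (F u) +
    pairing (f 1) (F u) - (W u a1 * pairing P (F u) +
    (W u v - W u a1) * pairing Q (F u)))).
  have := cocycle2_antidiag a1 2 Fc ue; rewrite !mulrz2 !addrA -/Y2 -/Y0 => ->.
  have -> : e + u + u - v = t + u by rewrite eE tE; zmodule.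
  congr (- _).
  pose g (a b : A) := W v a * antidiag (a1 - v) (t + u) a b +
    W v b * antidiag a1 (t + u) a b.
  pose psi := shift u 0 (F u) + shift 0 u (F u).
  have -> : pairing g (F (u + u)) = pairing g (2 *: psi + 0).
    apply: eq_pairingr => a b; rewrite /psi !cfE addr0 !shiftE !subr0 /g.
    rewrite ![(_ + _ * antidiag _ _ _ _) * _]mulrDl.
    congr (_ + _); rewrite ![_ * antidiag _ _ _ _ * _]mulrAC;
      apply: antidiag_eq => ea eb; congr (_ * _); apply: cocycle2_double => //.
    - by rewrite eb ea !Wlin ut; ring.
    - by rewrite ea !Wlin.
    - by rewrite eb ea !Wlin ut; ring.
    - by rewrite ea.
  rewrite pairing_linear pairing0 addr0; congr (_ * _).
  rewrite /psi -[shift u 0 _]scale1r pairing_linear mul1r !pairing_shift.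
  apply/eqP; rewrite eq_sym subr_eq; apply/eqP.
  rewrite -!pairingZ -!pairingD; apply: eq_pairing => a b; congr (_ * _).
  have hP : W u a * P a b = (W u a1 - W u v) * P a b.
    by apply: antidiag_eq => -> _; rewrite !Wlin.
  have hQ : W u b * Q a b = - W u a1 * Q a b.
    by apply: antidiag_eq => _ ->; rewrite ut sub0r.
  rewrite /f /g !antidiag_shift !subr0 addrK.
  rewrite !antidiag_line -/(P a b) -/(Q a b) !Wlin (WC v u).
  by lra.
move: E1 E2 E3; rewrite -/P -/Q; set p := pairing P _; set q := pairing Q _.
by move=> E1 E2 E3; lra.
Qed.

Lemma antidiag_sum0 F a1 d : is_cocycle2 F -> W u d = 0 -> W u a1 != 0 ->
  pairing (antidiag a1 (u + d)) (F u) = 0.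
Proof.
move=> Fc ud ua.
have [N Nb] := ex_bound (msupp (F u)) (fun k : A * A => `|om u k.1|%N).
have Np : (N.+1%:R : R) != 0 by rewrite pnatr_eq0.
(* With this choice a1 - v = (N + 2) a1 has a weight beyond every first weight in the support of F
   u, so the first sum in [antidiag_relation] vanishes. *)
pose v := a1 *~ (- N.+1%:Z).
have uv : W u v = - N.+1%:R * W u a1 by rewrite WMzr rmorphN.
have uv0' : W u v != 0 by rewrite uv mulf_neq0 // oppr_eq0.
have uav : W u a1 - W u v = N.+2%:R * W u a1 by rewrite uv -[N.+2]addn1 natrD; ring.
have := antidiag_relation Fc ud uv0' ua; rewrite uav mulf_neq0 // ?pnatr_eq0 //.
move=> /(_ isT); rewrite [X in _ * X + _]pairing_eq0 => [|a b].
  rewrite mulr0 add0r => /eqP; rewrite mulf_eq0 => /orP[|/eqP //].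
  by rewrite -opprB uav oppr_eq0 mulf_eq0 pnatr_eq0 (negPf ua).
rewrite /antidiag; case: asboolP => [[[j ej] _]|]; last by rewrite mul0r.
rewrite mul1r; apply/eqP; apply: contraT; rewrite cf_neq0 => /Nb /=.
have -> : om u a = N.+2%:Z * om u a1.
  apply: (@intr_inj R); rewrite rmorphM.
  by rewrite ej WDr WMzr Wxx mulr0 addr0 WDr WNr uav.
rewrite abszM; have : om u a1 != 0 by move: ua; rewrite intr_eq0.
by rewrite -absz_gt0 absz_nat; nia.
Qed.

(** * The first coboundary: confining F u to the orthogonal of [u] *)

Definition halfline (a b x y : A) : R :=
  (`[< exists n : nat, x = a + u *+ n.+1 /\ y = b - u *+ n >])%:R.

Lemma line_torsion_free n : u *+ n.+1 <> 0.
Proof.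
move=> /(congr1 (fun x => W v0 x)); rewrite WMnr W0r WC Wuv0 => /eqP.
by rewrite mulrN1 oppr_eq0 pnatr_eq0.
Qed.

(** Summation over half-lines is a formal inverse of t - s, by telescoping. *)
Lemma halflineB a b x y :
  halfline (a - u) b x y = ((x, y) == (a, b))%:R + halfline a (b - u) x y.
Proof.
rewrite /halfline xpair_eqE; case: (eqVneq x a) => [->|xa] /=.
  have -> : `[< exists n : nat, a = a + u *+ n.+1 /\ y = b - u - u *+ n >] = false.
    apply/asboolPn => -[n [/eqP + _]]; rewrite -subr_eq0 => /eqP e.
    by apply: (@line_torsion_free n); rewrite -[RHS]oppr0 -e; zmodule.
  rewrite addr0.
  congr (nat_of_bool _)%:R; apply/asboolP/eqP => [[n [ea ->]]|->].
    case: n ea => [|n] ea; first by rewrite mulr0n subr0.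
    case: (@line_torsion_free n); apply: (addrI a); rewrite addr0 [RHS]ea.
    by rewrite [u *+ n.+2]mulrS; zmodule.
  by exists 0%N; rewrite mulr0n mulr1n subr0 subrK.
rewrite add0r; congr (nat_of_bool _)%:R; apply: asbool_equiv_eq; split.
  move=> [[|n] [ex ->]]; first by rewrite ex mulr1n subrK eqxx in xa.
  exists n; rewrite ex; split; rewrite ?[u *+ n.+2]mulrS ?[u *+ n.+1]mulrS; zmodule.
move=> [n [-> ->]]; exists n.+1.
by split; rewrite ?[u *+ n.+2]mulrS ?[u *+ n.+1]mulrS; zmodule.
Qed.

(** A nonzero half-line sum needs a support point on the half-line and, since the full antidiagonal
    sums to 0, another on the complementary one. The base point lies between them, which leaves
    finitely many choices. *)
Lemma halfline_supp F : is_cocycle2 F ->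
  exists s : seq (A * A), forall a b, W u a != 0 -> W u a + W u b = 0 ->
    pairing (halfline a b) (F u) != 0 -> (a, b) \in s.
Proof.
move=> Fc.
have [N Nb] := ex_bound (msupp (F u)) (fun k : A * A => `|om k.1 v0|%N).
(* Both support points have [v0]-coordinate below [N] in absolute value, so they are less than 2 N
   apart. *)
exists [seq (k.1 - u *+ n.+1, k.2 + u *+ n) |
  k <- msupp (F u), n <- iota 0 (N + N)].
move=> a b ua uab pn.
have [x [y]] := pairing_neq0 pn; rewrite {1}/halfline.
case: asboolP => [[n [ex ey]]|]; last by rewrite mul0r eqxx.
rewrite mul1r cf_neq0 => xy.
pose rev (x y : A) := antidiag a (u + (a + b)) x y + -1 * halfline a b x y.
have : pairing rev (F u) != 0.
  rewrite pairingD pairingZ antidiag_sum0 ?WDr // add0r mulN1r oppr_eq0 //.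
move=> /pairing_neq0 [x' [y']]; rewrite /rev /antidiag /halfline.
case: asboolP => [[[j ex'] es]|na]; last first.
  case: asboolP => [[n' [ex' ey']]|_]; last by rewrite mulr0 addr0 mul0r eqxx.
  case: na; split; first by exists n'.+1.
  by rewrite ex' ey' mulrS; zmodule.
case: asboolP => [_|nh]; first by rewrite mulr1 subrr mul0r eqxx.
rewrite mulr0 addr0 mul1r cf_neq0 => xy'.
apply/allpairsP; exists ((x, y), n) => /=; split => //.
  rewrite mem_iota /= add0n.
  have j0 : j <= 0.
    case: j ex' => [[//|j]|//] ex'; case: nh; exists j; split => //.
    have -> : y' = u + (a + b) - x' by rewrite -es; zmodule.
    by rewrite ex' -[u *~ _]/(u *+ j.+1) mulrS; zmodule.
  have := Nb _ xy; have := Nb _ xy' => /=; rewrite ex' om_line.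
  by rewrite ex -[u *+ _]/(u *~ n.+1%:Z) om_line; lia.
by rewrite ex ey addrK subrK.
Qed.

Lemma mem_shift_supp phi x y a b : cf phi (a + x) (b + y) != 0 ->
  (a, b) \in [seq (k.1 - x, k.2 - y) | k <- msupp phi].
Proof.
by rewrite cf_neq0 => h; apply/mapP; exists (a + x, b + y); rewrite //= !addrK.
Qed.

(* Writing [al], [be] for the weights and [t], [s] for the two translations   *)
(* by [u], the action of [u] is [al t + be s], that of [2 u] is               *)
(* [2 (al t^2 + be s^2)], and                                                 *)
(* [al (al t^2 + be s^2) - (al t - be s) (al t + be s) = be (al + be) s^2].   *)
Lemma ex_potential F : is_cocycle2 F ->
  exists mu : T, forall a b, (W u a != 0) || (W u b != 0) ->
    cf (tact om u mu) a b = cf (F u) a b.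
Proof.
move=> Fc; pose X1 := F u; pose X2 := F (u *~ 2).
have [s sP] := halfline_supp Fc.
(* If be = 0 the action is al t, inverted directly. Otherwise, for al + be <> 0, the Bezout identity
   is applied to a putative solution, with [X1] and [X2] as its images under u and u^2. *)
pose pot (a b : A) : R := if W u a + W u b != 0 then
    if W u b == 0 then cf X1 (a + u) b / W u a
    else (W u a / 2 * cf X2 a (b + u + u) - W u a * cf X1 (a - u) (b + u + u)
          + W u b * cf X1 a (b + u)) / (W u b * (W u a + W u b))
  else pairing (halfline a b) X1 / W u a.
pose supp phi x y := [seq (k.1 - x, k.2 - y) | k <- msupp phi] : seq (A * A).
have cf_out phi x y a b : (a, b) \notin supp phi x y -> cf phi (a + x) (b + y) = 0.
  by move=> ns; apply/eqP; apply: contraNT ns; exact: mem_shift_supp.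
have [mu muE] : exists mu : T, forall a b, cf mu a b = pot a b.
  apply: (@malg_of_fun (supp X1 u 0 ++ supp X2 0 (u + u) ++
    supp X1 (- u) (u + u) ++ supp X1 0 u ++ s)) => a b.
  apply: contraR; rewrite !mem_cat !negb_or => /and5P[n1 n2 n3 n4 n5].
  rewrite /pot; move: (cf_out _ _ _ _ _ n1) (cf_out _ _ _ _ _ n2).
  move: (cf_out _ _ _ _ _ n3) (cf_out _ _ _ _ _ n4).
  rewrite !addr0 !addrA => -> -> -> ->; rewrite !mulr0 subr0 addr0 !mul0r.
  case: (eqVneq (W u a + W u b) 0) => [uab|_] /=; last by case: ifP.
  (* At weights (0, 0) division by zero makes [pot] vanish, as finite support demands. *)
  case: (eqVneq (W u a) 0) => [->|ua]; first by rewrite invr0 mulr0.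
  by rewrite mulf_eq0; apply/orP; left; apply: contraNT n5; exact: sP.
exists mu => a b nz; rewrite tactE !muE /pot !Wlin !subr0.
have := cocycle2_line 2 a (b + u + u) Fc; rewrite -/X1 -/X2 !Wlin !addr0.
rewrite !mulrz2 !opprD !addrA !addrK !subrK.
case: (eqVneq (W u a + W u b) 0) => [/eqP|] /= uab.
  have ub : W u b = - W u a by apply/eqP; rewrite -addr_eq0 addrC.
  have ua : W u a != 0 by move: nz; rewrite ub oppr_eq0 orbb.
  move=> _; rewrite ub mulNr ![W u a * (_ / _)]mulrC !divfK //.
  rewrite (@eq_pairing (halfline (a - u) b) (fun x y =>
    ((x, y) == (a, b))%:R + halfline a (b - u) x y)).
    by rewrite pairingD pairing_delta addrK.
  by move=> x y; rewrite halflineB.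
case: (eqVneq (W u b) 0) => ub.
  move=> _; rewrite ub mul0r addr0 mulrC divfK //.
  by move: nz; rewrite ub eqxx orbF.
move: uab ub; set al := W u a; set be := W u b.
set x2 := cf X2 _ _; set y2 := cf X2 _ _; set x1 := cf X1 _ _.
set z := cf X1 a b; set y1 := cf X1 _ _ => uab ub e.
transitivity ((al / 2 * (al * x2 + be * y2) - al ^+ 2 * x1 + be ^+ 2 * z) /
  (be * (al + be))); first by field; rewrite uab ub.
by rewrite e; field; rewrite uab ub.
Qed.

Definition antisym phi : Prop := forall a b, cf phi a b = - cf phi b a.

(** The action commutes with [swap], so the potential can be antisymmetrized. *)
Lemma ex_antisym_potential F : is_cocycle2 F -> antisym (F u) ->
  exists2 mu : T, antisym mu & forall a b,
    (W u a != 0) || (W u b != 0) -> cf (F u - tact om u mu) a b = 0.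
Proof.
move=> Fc Fa; have [mu muE] := ex_potential Fc.
exists (2^-1 *: (mu - swap mu)) => [a b|a b nz].
  by rewrite !cfE !swapE; lra.
have := muE b a; rewrite orbC => /(_ nz); have := muE _ _ nz; have := Fa a b.
by rewrite !(cfE, tactE, swapE) => e1 e2 e3; lra.
Qed.

(** * The second coboundary: cocycles with F(u^k) supported on the orthogonal of [u] *)

Section PerpCocycle.
Variable F : A -> T.
Hypothesis Fc : is_cocycle2 F.
Hypothesis Fa : forall v, antisym (F v).
Hypothesis Fu : forall k a b,
  (W u a != 0) || (W u b != 0) -> cf (F (u *~ k)) a b = 0.

(** Away from the weights (om u v, 0) and (0, om u v), v . F(u^k) vanishes and only u^k . F(v)
    remains. *)
Lemma act_line_off_axis v k a b :
  (W u a != W u v) || (W u b != 0) -> (W u a != 0) || (W u b != W u v) ->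
  k%:~R * W u v * cf (F (v + u *~ k)) a b =
  k%:~R * (W u a * cf (F v) (a - u *~ k) b + W u b * cf (F v) a (b - u *~ k)).
Proof.
move=> na nb; have := cocycle2E Fc (u *~ k) v a b.
rewrite [u *~ k + v]addrC !Wlin => ->.
rewrite (Fu k (a := a - v)) ?(Fu k (b := b - v)); first by ring.
  by rewrite WDr WNr subr_eq0.
by rewrite WDr WNr subr_eq0.
Qed.

(** Writing ga = om u v, F(v + 2 u) is reached by u^2 once or by u twice. Comparison gives ga (al
    t^2 + be s^2) F(v) = (al t + be s)^2 F(v), a nontrivial recurrence unless (al, be) is (0, 0),
    (ga, 0) or (0, ga). *)
Lemma supp_off_axis v a b : W u v != 0 ->
  (W u a != W u v) || (W u b != 0) -> (W u a != 0) || (W u b != W u v) ->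
  cf (F v) a b = 0.
Proof.
move=> uv na nb; case: (boolP ((W u a == 0) && (W u b == 0))).
  move=> /andP[/eqP ua /eqP ub].
  (* At weights (0, 0) the action of [u] is zero, so one step from [v - u] to [v] gives ga F(v) =
     0. *)
  have := @act_line_off_axis (v - u) 1 a b.
  rewrite !Wlin subr0 mulr1z subrK ua ub !(eq_sym 0) uv orbT => /(_ isT isT).
  by rewrite !mul0r addr0 mulr0 mul1r => /eqP; rewrite mulf_eq0 (negPf uv) => /eqP.
rewrite negb_and => nz.
pose al := W u a; pose be := W u b; pose ga := W u v.
apply: (@line_inj _ al be (al * (al - ga)) (2 * al * be) (be * (be - ga))) => //.
  move=> a' b' ua ub.
  have K1 := @act_line_off_axis (v + u) 1 (a' + u + u) b'.
  have K2 := @act_line_off_axis v 1 (a' + u) b'.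
  have K3 := @act_line_off_axis v 1 (a' + u + u) (b' - u).
  have K4 := @act_line_off_axis v 2 (a' + u + u) b'.
  move: K1 K2 K3 K4.
  rewrite !mulrz2 !mulr1z !mul1r !opprD !addrA !addrK !Wlin ua ub !subr0 !addr0.
  move=> /(_ na nb) K1 /(_ na nb) K2 /(_ na nb) K3 /(_ na nb) K4.
  move: K1 K2 K3 K4; rewrite -/al -/be -/ga.
  set X := cf (F (v + u + u)) _ _; set p := cf (F (v + u)) _ _.
  set q := cf (F (v + u)) _ _; set x := cf _ _ _; set y := cf _ _ _.
  set z := cf _ _ _ => K1 K2 K3 K4.
  have K5 : ga * X = al * x + be * z by lra.
  have : ga * (al * p + be * q) = ga * (al * x + be * z) by rewrite -K1 -K5.
  rewrite [in LHS]mulrDr ![ga * (_ * _)]mulrCA K2 K3 => K6; lra.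
rewrite !mulf_eq0 !negb_or pnatr_eq0 !subr_eq0 /= -/al -/be -/ga in na nb nz *.
case: (eqVneq al 0) na nb nz => [->|an]; case: (eqVneq be 0) => [->|bn] //=.
Qed.

(* The part of [F w] of weights [(om u w, 0)], read on the orthogonal of [u]. *)
Definition perp_part w p q : R := cf (F w) (w + p) q.

(** At (w + p, v + q) the cocycle identity for (v, w) keeps two terms: [supp_off_axis] removes the
    left side and one term of each action. *)
Lemma perp_part_cross v w p q :
  W u v != 0 -> W u w != 0 -> W u v + W u w != 0 -> W u w != W u v ->
  W u p = 0 -> W u q = 0 ->
  W v q * perp_part w p q = - W w p * perp_part v q p.
Proof.
move=> uv uw uvw une up uq; have := cocycle2E Fc v w (w + p) (v + q).
rewrite (supp_off_axis (v := v + w)); first last.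
- by rewrite !WDr up addr0 uw.
- by rewrite !WDr up addr0 -subr_eq0 opprD addrCA subrr addr0 oppr_eq0 uv.
- by rewrite WDr.
rewrite (supp_off_axis (v := w) (a := w + p - v)) //; first last.
- by rewrite !Wlin up addr0 subr_eq0 une.
- by rewrite !Wlin uq addr0 uv orbT.
rewrite (supp_off_axis (v := v) (b := v + q - w)) //; first last.
- by rewrite !Wlin up addr0 uw.
- by rewrite !Wlin up addr0 une.
rewrite ![_ + _ - _]addrAC !subrr !add0r (Fa v p) !Wlin /perp_part.
by move=> e; lra.
Qed.

Lemma perp_part_diag v w p q :
  W u v != 0 -> W u w != 0 -> W u v + W u w != 0 -> W u p = 0 -> W u q = 0 ->
  W v w * perp_part (v + w) p q =
  W v (w + p) * perp_part w p q - W w (v + p) * perp_part v p q.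
Proof.
move=> uv uw uvw up uq; rewrite /perp_part (cocycle2E Fc v w).
rewrite (supp_off_axis (v := w) (b := q - v)) //; first last.
- by rewrite !Wlin up addr0 uvw.
- by rewrite !Wlin up uq addr0 sub0r oppr_eq0 uv orbT.
rewrite (supp_off_axis (v := v) (b := q - w)) //; first last.
- by rewrite !Wlin up addr0 uvw.
- by rewrite !Wlin up uq addr0 sub0r oppr_eq0 uw orbT.
have -> : v + w + p - v = w + p by zmodule.
have -> : v + w + p - w = v + p by zmodule.
by rewrite !Wlin; ring.
Qed.

Lemma perp_part_line k v p q : W u v != 0 -> W u p = 0 -> W u q = 0 ->
  k%:~R * W u v * (perp_part (v + u *~ k) p q - perp_part v p q) =
  (k%:~R * W u v - W v p) * cf (F (u *~ k)) (u *~ k + p) q.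
Proof.
move=> uv up uq; have := cocycle2E Fc (u *~ k) v (v + u *~ k + p) q.
rewrite [u *~ k + v]addrC -/(perp_part _ _ _).
rewrite (Fu k (b := q - v)); last by rewrite !Wlin uq sub0r oppr_eq0 uv orbT.
have -> : v + u *~ k + p - v = u *~ k + p by zmodule.
have -> : v + u *~ k + p - u *~ k = v + p by zmodule.
rewrite -/(perp_part _ _ _) !Wlin up uq !mulr0 (WC v u).
by move=> e; lra.
Qed.

Lemma int_arith (x : int -> R) d : (forall k, x (k + 1) = x k + d) ->
  forall k, x k = x 0 + k%:~R * d.
Proof.
move=> xd; elim/int_ind => [|n IH|n IH]; first by rewrite mul0r addr0.
  have -> : n.+1%:Z = n%:Z + 1 by lia.
  by rewrite xd IH rmorphD rmorph1; ring.
have := xd (- n.+1%:Z); have -> : - n.+1%:Z = - n%:Z - 1 by lia.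
by rewrite subrK IH rmorphB rmorph1 => e; lra.
Qed.

Variable L : seq A.
Hypothesis LP : forall p, p != 0 ->
  exists2 v, v \in L & (W u v != 0) && (W v p != 0).

(** The increment [dl v] satisfies k^2 om(u,v) dl(v) = (k om(u,v) - om(v,p)) D(k), where [D] does
    not depend on [v]. Comparing several k and v forces D(1) = 0 or D(2) = 0, hence dl(v) = 0. *)
Lemma perp_part_periodic v p q : p != 0 -> W u p = 0 -> W u q = 0 ->
  W u v != 0 -> perp_part (v + u) p q = perp_part v p q.
Proof.
move=> pn up uq; pose D k := cf (F (u *~ k)) (u *~ k + p) q.
pose dl v := perp_part (v + u) p q - perp_part v p q.
have dlE w : W u w != 0 -> forall k : int, k != 0 ->
    k%:~R ^+ 2 * W u w * dl w = (k%:~R * W u w - W w p) * D k.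
  move=> uw k _; rewrite -perp_part_line //.
  (* The equation of [perp_part_line] for k = 1 sees [w] only through om u w and om w p, both
     unchanged by adding multiples of [u]. *)
  have ar : forall k, perp_part (w + u *~ (k + 1)) p q =
      perp_part (w + u *~ k) p q + dl w.
    move=> l; apply: (mulfI uw).
    have uwl : W u (w + u *~ l) != 0 by rewrite !Wlin mulr0 addr0.
    have := perp_part_line 1 uwl up uq; have := perp_part_line 1 uw up uq.
    rewrite mulrzDr !mulr1z addrA !Wlin up !mulr0 !addr0 !mul1r => <- e.
    by rewrite /dl; lra.
  by have := int_arith ar k; rewrite mulr0z addr0 => ->; ring.
move=> uv; apply/eqP; rewrite -subr_eq0 -/(dl v).
have uv1 : W u v0 != 0 by rewrite Wuv0 oner_eq0.
suff [D0|D0] : D 1 = 0 \/ D 2 = 0.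
- by have := dlE _ uv 1; rewrite D0 mulr0 expr1n mul1r => /(_ isT)/eqP;
    rewrite mulf_eq0 (negPf uv).
- by have := dlE _ uv 2; rewrite D0 mulr0 => /(_ isT)/eqP;
    rewrite !mulf_eq0 (negPf uv) intr_eq0 /= => ?.
pose j := om v0 p.
have E1 := dlE _ uv1 1 isT; have E2 := dlE _ uv1 2 isT.
case: (eqVneq j 0) => j0.
  have [w _ /andP[]] := LP pn; set y := W w p => uw wp; left.
  have := dlE _ uw 1 isT; have := dlE _ uw 2 isT; rewrite -/y.
  move: E1 E2; rewrite -/j j0 Wuv0 => E1 E2 E3 E4.
  have D2 : D 2 = 2 * D 1 by lra.
  have : y * D 1 = 0 by rewrite D2 in E3; lra.
  by move=> /eqP; rewrite mulf_eq0 (negPf wp) => /eqP.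
(* Taking k = j kills the right side, so dl(v0) = 0; then (k - j) D(k) = 0, where k = 1 or k = 2
   differs from j. *)
have := dlE _ uv1 j j0; rewrite -/j Wuv0 !mulr1 subrr mul0r => /eqP.
rewrite mulf_eq0 expf_eq0 /= intr_eq0 (negPf j0) /= => /eqP dl0.
move: E1 E2; rewrite -/j dl0 !mulr0 Wuv0 !mulr1 => /esym/eqP E1 /esym/eqP E2.
move: E1 E2; rewrite !mulf_eq0 !subr_eq0 !eqr_int.
case: (eqVneq 1 j) => [<- _ /= /eqP|_ /= /eqP]; first by right.
by left.
Qed.

(** Subtracting [perp_part_diag] for (x, y) from that for (x + u, y) shows, by periodicity,
    additivity in the monomial; reinserting this gives proportionality to om(-, p). The excluded
    case om u v + om u w = 0 passes through [v + v]. *)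
Lemma perp_part_prop v w p q : p != 0 -> W u p = 0 -> W u q = 0 ->
  W u v != 0 -> W u w != 0 -> W v p != 0 ->
  perp_part w p q = W w p * (perp_part v p q / W v p).
Proof.
move=> pn up uq.
have cross x y : W u x != 0 -> W u y != 0 -> W u x + W u y != 0 ->
    W x p * perp_part y p q = W y p * perp_part x p q.
  move=> ux uy uxy; have D1 := perp_part_diag ux uy uxy up uq.
  have uxu : W u (x + u) != 0 by rewrite !Wlin addr0.
  have uxyu : W u (x + u) + W u y != 0 by rewrite !Wlin addr0.
  have := perp_part_diag uxu uy uxyu up uq.
  rewrite addrAC !perp_part_periodic // ?WDr //.
  move: D1; rewrite !Wlin up (WC y u) (WC y x).
  set a := perp_part (x + y) p q; set b := perp_part y p q.
  set c := perp_part x p q => D1 D2.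
  have : W u y * (a - b - c) = 0 by lra.
  move=> /eqP; rewrite mulf_eq0 (negPf uy) -addrA -opprD subr_eq0 => /eqP ae.
  by rewrite ae in D1; lra.
move=> uv uw vp.
have dbl : W u (v + v) = 2 * W u v by rewrite WDr; ring.
have uvv : W u (v + v) != 0 by rewrite dbl mulf_neq0 // pnatr_eq0.
have E1 : perp_part (v + v) p q = 2 * perp_part v p q.
  apply: (mulfI vp); rewrite (cross v (v + v)) //; first by rewrite WDl; ring.
  by rewrite dbl (_ : _ + _ = 3 * W u v) ?mulf_neq0 ?pnatr_eq0 //; ring.
case: (eqVneq (W u v + W u w) 0) => [vw|vw].
  have E2 : W (v + v) p * perp_part w p q = W w p * perp_part (v + v) p q.
    by apply: cross => //; rewrite dbl (_ : _ + _ = W u v) //; lra.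
  apply: (mulfI vp); rewrite mulrCA [W v p * (_ / _)]mulrC divfK //.
  by rewrite E1 WDl in E2; lra.
apply: (mulfI vp); rewrite mulrCA [W v p * (_ / _)]mulrC divfK //.
exact: cross.
Qed.

Lemma ex_weight p (x : R) : p != 0 ->
  exists w, [/\ W u w != 0, W w p != 0, W u w != x & W u w != - x].
Proof.
move=> /LP [v _ /andP[uv vp]].
pose good (n : nat) := (W u (v *~ n) != x) && (W u (v *~ n) != - x).
have [n n0 /andP[g1 g2]] : exists2 n : nat, (0 < n)%N & good n.
  apply: contrapT => none.
  have bad n : (0 < n)%N -> (n%:R * W u v == x) || (n%:R * W u v == - x).
    move=> n0; apply: contraT; rewrite negb_or => g; case: none; exists n => //.
    by rewrite /good WMzr.
  have sq n : (0 < n)%N -> n%:R ^+ 2 * (W u v) ^+ 2 = x ^+ 2.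
    by move=> /bad /orP[] /eqP e; rewrite -exprMn e ?sqrrN.
  have s1 := sq 1%N isT; have s2 := sq 2%N isT.
  have : W u v ^+ 2 = 0 by rewrite expr1n mul1r in s1; rewrite -s1 in s2; lra.
  by move=> /eqP; rewrite expf_eq0 (negPf uv).
have nn : ((n%:Z)%:~R : R) != 0 by rewrite intr_eq0; lia.
exists (v *~ n); split => //.
  by rewrite WMzr mulf_neq0.
by rewrite WMzl mulf_neq0.
Qed.

Lemma perp_part_0l v q : q != 0 -> W u q = 0 -> W u v != 0 ->
  perp_part v 0 q = 0.
Proof.
move=> qn uq uv; have [w [uw wq n1 n2]] := ex_weight (W u v) qn.
have := @perp_part_cross v w q 0 uv uw.
rewrite addrC addr_eq0 n2 n1 uq !W0r mul0r => /(_ isT isT erefl erefl)/eqP.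
by rewrite mulNr eq_sym oppr_eq0 mulf_eq0 (negPf wq) => /eqP.
Qed.

(** Choosing from the finite list [L] is what keeps the support of the second potential finite. *)
Definition dual_vec p := nth 0 L (find (fun v => (W u v != 0) && (W v p != 0)) L).

Lemma dual_vecP p : p != 0 ->
  [/\ dual_vec p \in L, W u (dual_vec p) != 0 & W (dual_vec p) p != 0].
Proof.
move=> /LP [v vL vp].
have h : has (fun v => (W u v != 0) && (W v p != 0)) L by apply/hasP; exists v.
have /andP[] := nth_find 0 h; split=> //.
by rewrite mem_nth // -has_find.
Qed.

(* For [p = 0] this is [0], by division by zero. *)
Definition perp_coef p q := perp_part (dual_vec p) p q / W (dual_vec p) p.

Lemma perp_partE w p q : p != 0 -> W u p = 0 -> W u q = 0 -> W u w != 0 ->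
  perp_part w p q = W w p * perp_coef p q.
Proof.
by move=> pn up uq uw; have [_ ? ?] := dual_vecP pn; exact: perp_part_prop.
Qed.

Lemma perp_coefC p q : p != 0 -> q != 0 -> W u p = 0 -> W u q = 0 ->
  perp_coef p q = - perp_coef q p.
Proof.
move=> pn qn up uq; have [_ uv vq] := dual_vecP qn.
set v := dual_vec q in uv vq; have [w [uw wp n1 n2]] := ex_weight (W u v) pn.
have := perp_part_cross uv uw _ n1 up uq.
rewrite addrC addr_eq0 n2 => /(_ isT); rewrite !perp_partE // => e.
have : W v q * W w p * (perp_coef p q + perp_coef q p) = 0 by lra.
by move=> /eqP; rewrite !mulf_eq0 (negPf vq) (negPf wp) /= addr_eq0 => /eqP.
Qed.

Lemma ex_perp_potential : exists2 mu : T, antisym mu &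
  forall w a b, W u w != 0 -> (a, b) != (w, 0) -> (a, b) != (0, w) ->
    cf (F w - tact om w mu) a b = 0.
Proof.
(* As [perp_coef 0 b] is only a default value, the entries with a = 0 are prescribed by
   antisymmetry. *)
pose f a b : R := if (W u a == 0) && (W u b == 0) then
  if a == 0 then - perp_coef b 0 else perp_coef a b else 0.
have [mu muE] : exists mu : T, forall a b, cf mu a b = f a b.
  pose s := [seq (k.1 - v, k.2) | v <- L, k <- enum_fset (msupp (F v))].
  apply: (@malg_of_fun (s ++ [seq (k.2, k.1) | k <- s])) => a b.
  have sP p q : p != 0 -> perp_coef p q != 0 -> (p, q) \in s.
    move=> pn; have [vL _ _] := dual_vecP pn.
    rewrite mulf_eq0 negb_or /perp_part cf_neq0 => /andP[h _].
    apply/allpairsPdep; exists (dual_vec p), (dual_vec p + p, q); split => //.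
    by rewrite /= addrAC subrr add0r.
  rewrite /f mem_cat; case: ifP; rewrite ?eqxx // => _.
  case: (eqVneq a 0) => [->|an] nz; last by rewrite (sP _ _ an nz).
  apply/orP; right; apply/mapP; exists (b, 0) => //; apply: sP.
    by apply: contraNneq nz => ->; rewrite oppr_eq0 /perp_coef W0r invr0 mulr0.
  by rewrite -oppr_eq0.
have mu_perp a b : (W u a != 0) || (W u b != 0) -> cf mu a b = 0.
  by rewrite muE /f -negb_and => /negPf ->.
have muA : antisym mu.
  move=> a b; rewrite !muE /f andbC; case: ifP => [/andP[/eqP ub /eqP ua]|_];
    last by rewrite oppr0.
  case: (eqVneq a 0) => [->|an]; case: (eqVneq b 0) => [->|bn].
  - by rewrite /perp_coef W0r invr0 mulr0 !oppr0.
  - by [].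
  - by rewrite opprK.
  - exact: perp_coefC.
exists mu => // w a b uw n1 n2; rewrite !cfE tactE.
have axis c d : (c, d) != (w, 0) -> W u c = W u w -> W u d = 0 ->
    cf (F w) c d = W w c * cf mu (c - w) d + W w d * cf mu c (d - w).
  move=> n uc ud; rewrite [X in _ + _ * X]mu_perp ?uc ?uw // mulr0 addr0.
  have [p cE] : exists p, c = w + p by exists (c - w); zmodule.
  have up : W u p = 0 by move: uc; rewrite cE !Wlin; lra.
  rewrite cE -/(perp_part w p d) addrAC subrr !Wlin !add0r muE /f up ud !eqxx /=.
  case: (eqVneq p 0) => [p0|pn]; last exact: perp_partE.
  rewrite p0 W0r mul0r; apply: perp_part_0l => //.
  by apply: contraNneq n => ->; rewrite cE p0 addr0.
case: (boolP ((W u a == W u w) && (W u b == 0))) => [/andP[/eqP ua /eqP ub]|na].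
  by rewrite (axis a b) // subrr.
case: (boolP ((W u b == W u w) && (W u a == 0))) => [/andP[/eqP ub /eqP ua]|nb].
  rewrite (Fa w) (axis b a) //; last first.
    by apply: contraNneq n2 => -[-> ->].
  by rewrite (muA _ a) (muA b); ring.
rewrite negb_and in na; rewrite negb_and orbC in nb.
rewrite supp_off_axis // !mu_perp ?mulr0 ?addr0 ?subr0 //.
  by rewrite WDr WNr subr_eq0.
by rewrite WDr WNr subr_eq0.
Qed.
End PerpCocycle.

(** * Multiples of v /\ 1, and the normal form of cocycles *)

Variable L : seq A.
Hypothesis LP : forall p, p != 0 ->
  exists2 v, v \in L & (W u v != 0) && (W v p != 0).

(** Finitely many hyperplanes do not cover A: a large multiple of an earlier solution dominates the
    correction for the new vector. *)
Lemma ex_generic (s : seq A) : (forall x, x \in s -> x != 0) ->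
  exists z, forall x, x \in s -> W x z != 0.
Proof.
elim: s => [|x s IH] sn; first by exists 0.
have [|z zP] := IH; first by move=> y ys; apply: sn; rewrite inE ys orbT.
case: (eqVneq (W x z) 0) => xz; last first.
  by exists z => y; rewrite inE => /orP[/eqP ->|/zP].
have [z' _ /andP[_ zx]] := LP (sn x (mem_head _ _)).
have [n nP] := ex_bound s (fun y => `|om y z'|%N).
exists (z' + z *~ n%:Z) => y; rewrite inE => /orP[/eqP ->|ys].
  by rewrite !Wlin xz mulr0 addr0 WC oppr_eq0.
rewrite !Wlin -rmorphM -rmorphD intr_eq0; apply: contraTneq (nP _ ys) => e.
have := zP _ ys; rewrite intr_eq0 => yz.
have -> : om y z' = - (n%:Z * om y z) by lia.
by rewrite abszN abszM -leqNgt; move: yz; rewrite -absz_gt0; nia.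
Qed.

(** The unit is central, so the identity for (v, 0) says that v . F(0) = 0 for all v. Invariance
    kills every coefficient except at (0, 0), where antisymmetry does. *)
Lemma cocycle2_0 F : is_cocycle2 F -> antisym (F 0) -> F 0 = 0.
Proof.
move=> Fc Fa; have act0 v a b : cf (tact om v (F 0)) a b = 0.
  have := cocycle2E Fc v 0 a b; rewrite !W0l W0r !mul0r addr0 subr0 => e.
  by rewrite tactE -e.
have perp a b : (W u a != 0) || (W u b != 0) -> cf (F 0) a b = 0.
  by apply: tact_inj => *; exact: act0.
have left a b : a != 0 -> cf (F 0) a b = 0.
  move=> /LP [v _ /andP[uv va]].
  case: (boolP ((W u a == 0) && (W u b == 0))) => [/andP[/eqP ua /eqP ub]|];
    last by rewrite negb_and; exact: perp.
  have := act0 v (a + v) b; rewrite tactE addrK [X in _ + _ * X]perp.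
    by move/eqP; rewrite mulr0 addr0 !Wlin addr0 mulf_eq0 (negPf va) => /eqP.
  by rewrite !Wlin ub sub0r oppr_eq0 uv orbT.
apply: cfP => a b; rewrite cf0; case: (eqVneq a 0) => [->|]; last exact: left.
case: (eqVneq b 0) => [->|bn]; first by have := Fa 0 0; lra.
by rewrite Fa left ?oppr0.
Qed.

(** The tensor of x /\ 1: the exponent 0 is the unit of the group algebra. *)
Definition wedge1 x : T := << (x, 0) >> - << (0, x) >>.

Lemma tact_wedge1 z x : tact om z (wedge1 x) = W z x *: wedge1 (z + x).
Proof.
rewrite linearB /= !tactU !W0r !scale0r add0r addr0 -scalerBr.
by rewrite [x + z]addrC.
Qed.

Lemma cf_wedge1 x : x != 0 -> cf (wedge1 x) x 0 = 1.
Proof.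
by move=> xn; rewrite !cfE !cfU eqxx xpair_eqE (negPf xn) andbF subr0.
Qed.

Lemma tact_wedge1_eq0 (r s : R) v phi : v != 0 ->
  r *: wedge1 v - s *: wedge1 v = tact om v phi -> r = s.
Proof.
move=> vn /(congr1 (fun phi => cf phi v 0)).
rewrite cfD cfN !cfZ cf_wedge1 // tactE Wxx W0r !mulr1 !mul0r addr0 => /eqP.
by rewrite subr_eq0 => /eqP.
Qed.

Lemma additive_cocycle2 (K : A -> R) : (forall v w, K (v + w) = K v + K w) ->
  is_cocycle2 (fun v => K v *: wedge1 v).
Proof.
move=> KD v w; have tactZ z c phi : tact om z (c *: phi) = c *: tact om z phi.
  exact: linearZ.
rewrite !tactZ !tact_wedge1 [w + v]addrC (WC w v) KD.
by apply: cfP => a b; rewrite !cfE; ring.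
Qed.

Lemma cocycle2_wedge1 G (K : A -> R) v w : is_cocycle2 G ->
  G v = K v *: wedge1 v -> G w = K w *: wedge1 w ->
  W v w *: G (v + w) = (W v w * (K v + K w)) *: wedge1 (v + w).
Proof.
move=> Gc Gv Gw; have tactZ z c phi : tact om z (c *: phi) = c *: tact om z phi.
  exact: linearZ.
rewrite -Gc Gv Gw !tactZ !tact_wedge1 [w + v]addrC (WC w v).
by apply: cfP => a b; rewrite !cfE; ring.
Qed.

(** The cocycle identity gives additivity when om v w <> 0. Otherwise a generic [z] and the two
    bracketings of v + w + z reduce to that case. *)
Lemma cocycle2_additive G (K : A -> R) : is_cocycle2 G ->
  (forall v, G v = K v *: wedge1 v) -> K 0 = 0 ->
  forall v w, K (v + w) = K v + K w.
Proof.
move=> Gc GK K0.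
have add v w : W v w != 0 -> K (v + w) = K v + K w.
  move=> vw; have vwn : v + w != 0.
    apply: contra vw; rewrite addrC addr_eq0 => /eqP ->.
    by rewrite WNr Wxx oppr0.
  have := cocycle2_wedge1 Gc (GK v) (GK w).
  move/(congr1 (fun phi => cf phi (v + w) 0)); rewrite GK !cfZ cf_wedge1 // !mulr1.
  exact: mulfI.
move=> v w; case: (eqVneq v 0) => [->|vn]; first by rewrite K0 !add0r.
case: (eqVneq w 0) => [->|wn]; first by rewrite K0 !addr0.
case: (eqVneq (v + w) 0) => [/eqP|vwn].
  rewrite addrC addr_eq0 => /eqP ->; rewrite addNr K0.
  have [z _ /andP[_ zv]] := LP vn.
  have := add v (z - v); rewrite WDr WNr Wxx subr0 (WC v z) oppr_eq0 => /(_ zv).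
  have := add z (- v); rewrite WNr oppr_eq0 => /(_ zv) ->.
  by rewrite addrC subrK => e; lra.
have [|z zP] := @ex_generic [:: v; w; v + w].
  by move=> x; rewrite !inE => /or3P[] /eqP ->.
have zv : W v z != 0 by apply: zP; rewrite !inE eqxx.
have zw : W w z != 0 by apply: zP; rewrite !inE eqxx orbT.
have zvw : W (v + w) z != 0 by apply: zP; rewrite !inE eqxx !orbT.
case: (eqVneq (W v w) 0) => [vw|]; last exact: add.
have : K (v + (w + z)) = K v + K (w + z) by apply: add; rewrite WDr vw add0r.
by rewrite addrA (add _ _ zvw) (add _ _ zw) => e; lra.
Qed.

Theorem cocycle2_normal_form F : is_cocycle2 F -> (forall v, antisym (F v)) ->
  exists (mu : T) (K : A -> R), [/\ antisym mu,
    forall v w, K (v + w) = K v + K w &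
    forall v, F v = tact om v mu + K v *: wedge1 v].
Proof.
move=> Fc Fa.
have tactA v mu : antisym mu -> antisym (tact om v mu).
  by move=> muA a b; rewrite !tactE (muA _ b) (muA a); ring.
have antisymB phi psi : antisym phi -> antisym psi -> antisym (phi - psi).
  by move=> phiA psiA a b; rewrite !cfE (phiA a) (psiA a); ring.
have [mu1 mu1A mu1P] := ex_antisym_potential Fc (Fa u).
pose F1 v := F v - tact om v mu1.
have F1c : is_cocycle2 F1 by exact: cocycle2B_tact.
have F1A v : antisym (F1 v).
  exact: (antisymB _ _ (Fa v) (tactA v _ mu1A)).
have [mu2 mu2A mu2P] := ex_perp_potential F1c F1A (cocycle2_perp F1c mu1P) LP.
pose G v := F1 v - tact om v mu2.
have Gc : is_cocycle2 G by exact: cocycle2B_tact.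
have GA v : antisym (G v).
  exact: (antisymB _ _ (F1A v) (tactA v _ mu2A)).
pose K v := cf (G v) v 0.
have G0 : G 0 = 0 by exact: cocycle2_0.
have GK0 w : W u w != 0 -> G w = K w *: wedge1 w.
  move=> uw; have wn : w != 0 by apply: contraNneq uw => ->; rewrite W0r.
  apply: cfP => a b; rewrite cfZ.
  have -> : cf (wedge1 w) a b = ((a, b) == (w, 0))%:R - ((a, b) == (0, w))%:R.
    by rewrite !cfE !cfU ![_ == (a, b)]eq_sym.
  case: (eqVneq (a, b) (w, 0)) => [[-> ->]|n1].
    by rewrite xpair_eqE (negPf wn) subr0 mulr1.
  case: (eqVneq (a, b) (0, w)) => [[-> ->]|n2].
    by rewrite GA sub0r mulrN1.
  by rewrite subrr mulr0; exact: mu2P.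
have GK w : G w = K w *: wedge1 w.
  case: (eqVneq w 0) => [->|wn]; first by rewrite /K G0 cf0 scale0r.
  case: (eqVneq (W u w) 0) => uw; last exact: GK0.
  (* Both [z] and [w - z] have nonzero weight and om z (w - z) = om z w <> 0, so their bracket
     recovers [w]. *)
  have [z _ /andP[uz zw]] := LP wn.
  have uwz : W u (w - z) != 0 by rewrite !Wlin uw sub0r oppr_eq0.
  have := cocycle2_wedge1 Gc (GK0 _ uz) (GK0 _ uwz).
  have -> : z + (w - z) = w by zmodule.
  rewrite !Wlin oppr0 addr0 -scalerA => /(scalerI zw) e.
  have Kw : cf (G w) w 0 = K z + K (w - z) by rewrite e cfZ cf_wedge1 // mulr1.
  by rewrite e -Kw.
exists (mu1 + mu2), K; split.
- by move=> a b; rewrite !cfE (mu1A a) (mu2A a); ring.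
- by apply: (cocycle2_additive Gc GK); rewrite /K G0 cf0.
- by move=> v; rewrite -GK /G /F1 linearD /=; zmodule.
Qed.

End TensorSquare.

(** * The exterior square as the space of antisymmetric tensors *)

HB.lock Definition alt_tensor (R : realFieldType) (A : zmodType)
    (x y : {malg R[A]}) : {malg R[(A * A)%type]} :=
  linext (fun a => linext (fun b => << (a, b) >> - << (b, a) >>) y) x.

HB.lock Definition ext2_tensor (R : realFieldType) (A : zmodType)
    (q : ext2 {malg R[A]}) : {malg R[(A * A)%type]} :=
  ext2_lift (@alt_tensor R A) q.

(** The factor 1/2 compensates for x /\ y being sent to a difference of two tensors. *)
HB.lock Definition tensor_lift (R : realFieldType) (A : zmodType)
    (N : lmodType R) (w : {malg R[A]} -> {malg R[A]} -> N)
    (phi : {malg R[(A * A)%type]}) : N :=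
  linext (fun k => 2^-1 *: w << k.1 >> << k.2 >>) phi.

Section ExteriorSquareTensor.
Variables (R : realFieldType) (A : zmodType).
Local Notation V := {malg R[A]}.
Local Notation T := {malg R[(A * A)%type]}.
Implicit Types (x y : V) (q : ext2 V) (phi : T).

Lemma cf_alt_tensor x y a b :
  cf (alt_tensor x y) a b = x@_a * y@_b - x@_b * y@_a.
Proof.
rewrite alt_tensor.unlock; elim/malg_lin_ind: x => [|c|r x x' IH IH'].
- by rewrite linear0 cf0 !mcoeff0; ring.
- rewrite linextU; elim/malg_lin_ind: y => [|d|r y y' IH IH'].
  + by rewrite linear0 cf0 !mcoeff0; ring.
  + rewrite linextU !cfE !cfU !mcoeffU !xpair_eqE.
    by rewrite -!mulnb !natrM; ring.
  + by rewrite linearP !cfE IH IH' !mcoeffD !mcoeffZ; ring.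
- by rewrite linearP !cfE IH IH' !mcoeffD !mcoeffZ; ring.
Qed.

Fact alt_tensor_linl (w : V) : linear (fun x => alt_tensor x w).
Proof.
by move=> r x y; apply: cfP => a b;
  rewrite !cfE !cf_alt_tensor !mcoeffD !mcoeffZ; ring.
Qed.

Fact alt_tensor_linr (w : V) : linear (alt_tensor w).
Proof.
by move=> r x y; apply: cfP => a b;
  rewrite !cfE !cf_alt_tensor !mcoeffD !mcoeffZ; ring.
Qed.

Fact alt_tensor_alt x : alt_tensor x x = 0.
Proof. by apply: cfP => a b; rewrite cf_alt_tensor cf0; ring. Qed.

Lemma alt_tensor0l x : alt_tensor 0 x = 0.
Proof. by apply: cfP => a b; rewrite cf_alt_tensor cf0 !mcoeff0; ring. Qed.

Lemma alt_tensor0r x : alt_tensor x 0 = 0.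
Proof. by apply: cfP => a b; rewrite cf_alt_tensor cf0 !mcoeff0; ring. Qed.

Lemma alt_tensorU (a b : A) :
  alt_tensor (<< a >> : V) << b >> = << (a, b) >> - << (b, a) >>.
Proof. by rewrite alt_tensor.unlock !linextU. Qed.

Lemma ext2_tensorP : linear (@ext2_tensor R A).
Proof.
rewrite ext2_tensor.unlock.
exact: (ext2_lift_linear alt_tensor_linl alt_tensor_linr alt_tensor_alt).
Qed.

Lemma ext2_tensor0 : ext2_tensor (0 : ext2 V) = 0.
Proof. by have := ext2_tensorP (-1) 0 0; rewrite scaler0 addr0 scaleN1r addNr. Qed.

Lemma ext2_tensorE x y : ext2_tensor (wedge x y) = alt_tensor x y.
Proof.
rewrite ext2_tensor.unlock.
exact: (ext2_liftE alt_tensor_linl alt_tensor_linr alt_tensor_alt).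
Qed.

Lemma ext2_tensor_antisym q : antisym (ext2_tensor q).
Proof.
move=> a b; elim/ext2_lin_ind: q => [|x y|r q q' IH IH'].
- by rewrite ext2_tensor0 !cf0 oppr0.
- by rewrite ext2_tensorE !cf_alt_tensor; ring.
- by rewrite ext2_tensorP !cfE IH IH'; ring.
Qed.

Section TensorLift.
Variables (N : lmodType R) (w : V -> V -> N).

Lemma tensor_liftP : linear (tensor_lift w).
Proof. by rewrite tensor_lift.unlock; exact: linext_linear. Qed.

Lemma tensor_liftU (a b : A) :
  tensor_lift w << (a, b) >> = 2^-1 *: w << a >> << b >>.
Proof. by rewrite tensor_lift.unlock linextU. Qed.

Lemma tensor_lift0 : tensor_lift w 0 = 0.
Proof.
by have := tensor_liftP (-1) 0 0; rewrite scaler0 addr0 scaleN1r addNr.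
Qed.

Hypothesis w_linl : forall z, linear (w^~ z).
Hypothesis w_linr : forall z, linear (w z).
Hypothesis wC : forall x y, w x y = - w y x.

Lemma tensor_lift_alt x y : tensor_lift w (alt_tensor x y) = w x y.
Proof.
have w0l z : w 0 z = 0.
  by have := w_linl z (-1) 0 0; rewrite scaler0 addr0 scaleN1r addNr.
have w0r z : w z 0 = 0.
  by have := w_linr z (-1) 0 0; rewrite scaler0 addr0 scaleN1r addNr.
elim/malg_lin_ind: x => [|a|r x x' IH IH'].
- by rewrite w0l alt_tensor0l tensor_lift0.
- elim/malg_lin_ind: y => [|b|r y y' IH IH'].
  + by rewrite w0r alt_tensor0r tensor_lift0.
  + have -> : alt_tensor (<< a >> : V) << b >> =
        (-1 : R) *: << (b, a) >> + << (a, b) >>.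
      by rewrite alt_tensorU scaleN1r addrC.
    rewrite tensor_liftP !tensor_liftU [w << b >> _]wC.
    rewrite scaleN1r scalerN opprK -mulr2n -scaler_nat scalerA.
    by rewrite divff ?scale1r // pnatr_eq0.
  + by rewrite alt_tensor_linr w_linr tensor_liftP IH IH'.
- by rewrite alt_tensor_linl w_linl tensor_liftP IH IH'.
Qed.

End TensorLift.

Lemma ext2_tensor_inj : injective (@ext2_tensor R A).
Proof.
have K q : tensor_lift (@wedge R V) (ext2_tensor q) = q.
  elim/ext2_lin_ind: q => [|x y|r q q' IH IH'].
  - by rewrite ext2_tensor0 tensor_lift0.
  - rewrite ext2_tensorE; apply: tensor_lift_alt.
    + exact: wedge_linl.
    + exact: wedge_linr.
    + exact: wedgeC.
  - by rewrite ext2_tensorP tensor_liftP IH IH'.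
exact: can_inj K.
Qed.

Lemma ext2_tensor_onto phi : antisym phi -> exists q, ext2_tensor q = phi.
Proof.
move=> pa; exists (tensor_lift (@wedge R V) phi).
have -> : ext2_tensor (tensor_lift (@wedge R V) phi) = 2^-1 *: (phi - swap phi).
  elim/malg_lin_ind: {pa} phi => [|[a b]|r phi psi IH IH'].
  - by rewrite tensor_lift0 ext2_tensor0 linear0 subr0 scaler0.
  - rewrite tensor_liftU -[_ *: wedge _ _]addr0 ext2_tensorP ext2_tensor0 addr0.
    by rewrite ext2_tensorE alt_tensorU swapU.
  - rewrite tensor_liftP ext2_tensorP IH IH'; apply: cfP => c d.
    by rewrite !(cfE, swapE); ring.
by apply: cfP => a b; rewrite !cfE swapE (pa b a); lra.
Qed.

End ExteriorSquareTensor.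

(* Locked copies at [W1 R g], for the same reason as [cf]. *)
HB.lock Definition w1coef (R : realType) (g : nat) (x : W1 R g) (a : expo g) : R :=
  (x : {malg R[expo g]})@_a.

HB.lock Definition w1tensor (R : realType) (g : nat) (q : ext2 (W1 R g)) :
    {malg R[(expo g * expo g)%type]} :=
  @ext2_tensor R (expo g) q.

(** * Transfer to W_1(g): linearity and injectivity *)

Section WilsonLoops.
Variables (R : realType) (g : nat).
Local Notation A := (expo g).
Local Notation om := (@intersection g).
Local Notation W x y := ((om x y)%:~R : R).
Local Notation L1 := (W1 R g).
Local Notation T := {malg R[(A * A)%type]}.
Implicit Types (x y : L1) (q : ext2 L1) (a b v : A).

Lemma w1coef0 a : w1coef (0 : L1) a = 0.
Proof. by rewrite w1coef.unlock; exact: mcoeff0. Qed.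

Lemma w1coefP r x y a : w1coef (r *: x + y) a = r * w1coef x a + w1coef y a.
Proof.
rewrite w1coef.unlock; apply: etrans (mcoeffD _ _ _) _.
by congr (_ + _); exact: mcoeffZ.
Qed.

Lemma w1coefU v a : w1coef (monom R v) a = (v == a)%:R.
Proof. by rewrite w1coef.unlock; exact: mcoeffU. Qed.

Lemma W1_ind (P : L1 -> Prop) : P 0 -> (forall v, P (monom R v)) ->
  (forall r x y, P x -> P y -> P (r *: x + y)) -> forall x, P x.
Proof. exact: malg_lin_ind. Qed.

Lemma w1coef_lie v x a : w1coef (lie (monom R v) x) a = W v a * w1coef x (a - v).
Proof.
elim/W1_ind: x => [|b|r x y IH IH'].
- by rewrite linear0 !w1coef0 mulr0.
- rewrite [lie _ _]W1_lieE -[_ *: _]addr0 w1coefP w1coef0 addr0 !w1coefU.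
  rewrite -[b == a - v](inj_eq (addIr v)) subrK addrC.
  case: eqVneq => [<-|_]; rewrite ?mulr0 // intersectionDr.
  by rewrite [om v v](_ : _ = 0) ?addr0 //; have := intersectionC v v; lia.
- rewrite lie_linr; apply: etrans (w1coefP _ _ _ _) _.
  by rewrite [X in r * X + _]IH [X in _ + X]IH' w1coefP; ring.
Qed.

Lemma w1tensor_wedge x y : w1tensor (wedge x y) = @alt_tensor R A x y.
Proof. by rewrite w1tensor.unlock; exact: ext2_tensorE. Qed.

Lemma cf_w1alt x y a b : cf (@alt_tensor R A x y) a b =
  w1coef x a * w1coef y b - w1coef x b * w1coef y a.
Proof. by rewrite w1coef.unlock; exact: cf_alt_tensor. Qed.

Lemma w1tensorP r q q' :
  w1tensor (r *: q + q') = r *: w1tensor q + w1tensor q'.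
Proof. by rewrite w1tensor.unlock; exact: ext2_tensorP. Qed.

Lemma w1tensor_inj : injective (@w1tensor R g).
Proof. by rewrite w1tensor.unlock; exact: ext2_tensor_inj. Qed.

Lemma w1tensor_onto (phi : T) : antisym phi -> exists q, w1tensor q = phi.
Proof. by rewrite w1tensor.unlock; exact: ext2_tensor_onto. Qed.

Lemma w1tensor_antisym q : antisym (w1tensor q).
Proof. by rewrite w1tensor.unlock; exact: ext2_tensor_antisym. Qed.

Lemma w1tensor0 : w1tensor (0 : ext2 L1) = 0.
Proof.
by have := w1tensorP (-1) 0 0; rewrite scaler0 addr0 scaleN1r addNr.
Qed.

Lemma w1tensorD q q' : w1tensor (q + q') = w1tensor q + w1tensor q'.
Proof. by have := w1tensorP 1 q q'; rewrite !scale1r. Qed.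

Lemma w1tensorZ r q : w1tensor (r *: q) = r *: w1tensor q.
Proof. by have := w1tensorP r q 0; rewrite w1tensor0 !addr0. Qed.

Lemma w1tensorB q q' : w1tensor (q - q') = w1tensor q - w1tensor q'.
Proof. by rewrite -scaleN1r w1tensorD w1tensorZ scaleN1r. Qed.

(* Stated for variables [x'] and [y'], as matching against [lie] is slow.     *)
Fact alt_tensor_der v x y x' y' :
  (forall a, w1coef x' a = W v a * w1coef x (a - v)) ->
  (forall a, w1coef y' a = W v a * w1coef y (a - v)) ->
  @alt_tensor R A x' y + @alt_tensor R A x y' = tact om v (@alt_tensor R A x y).
Proof.
move=> x'E y'E; apply: cfP => a b.
rewrite cfD (tactE (@intersectionDr g) (@intersectionC g)).
by rewrite !cf_w1alt !x'E !y'E; ring.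
Qed.

Lemma w1tensor_act v q :
  w1tensor (act (monom R v) q) = tact om v (w1tensor q).
Proof.
elim/ext2_lin_ind: q => [|x y|r q q' IH IH'].
- by rewrite act0 w1tensor0 linear0.
- rewrite [act _ _]ext2_actE; apply: etrans (w1tensorD _ _) _.
  rewrite [X in X + _]w1tensor_wedge [X in _ + X]w1tensor_wedge.
  by rewrite [in RHS]w1tensor_wedge; apply: alt_tensor_der; exact: w1coef_lie.
- rewrite act_linr; apply: etrans (w1tensorP _ _ _) _.
  by rewrite [X in r *: X + _]IH [X in _ + X]IH' w1tensorP linearP.
Qed.

Fact linear_monom_eq0 (N : lmodType R) (h : L1 -> N) : linear h ->
  (forall v, h (monom R v) = 0) -> forall x, h x = 0.
Proof.
move=> h_lin hU; elim/W1_ind => [|v|r x y IH IH']; [|exact: hU|].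
  by have := h_lin (-1) 0 0; rewrite scaler0 addr0 scaleN1r addNr.
by rewrite h_lin IH IH' scaler0 addr0.
Qed.

Fact linear_sub3 (N : lmodType R) (f1 f2 f3 : L1 -> N) :
  linear f1 -> linear f2 -> linear f3 -> linear (fun x => f1 x - f2 x - f3 x).
Proof. by move=> l1 l2 l3 r x y; rewrite l1 l2 l3 !scalerBr; zmodule. Qed.

Lemma linear_lie_monom (f : L1 -> ext2 L1) v w : linear f ->
  f (lie (monom R v) (monom R w)) = W v w *: f (monom R (v + w)).
Proof.
move=> f_lin; rewrite [lie _ _]W1_lieE.
have gen (N : lmodType R) (h : L1 -> N) c x : linear h -> h (c *: x) = c *: h x.
  move=> h_lin; have h0 : h 0 = 0.
    by have := h_lin (-1) 0 0; rewrite scaler0 addr0 scaleN1r addNr.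
  by have := h_lin c x 0; rewrite h0 !addr0.
exact: gen.
Qed.

Lemma cocycle_is_cocycle2 (f : L1 -> ext2 L1) : is_cocycle f ->
  is_cocycle2 om (fun v => w1tensor (f (monom R v))).
Proof.
move=> [f_lin fc] v w; rewrite -w1tensorZ -linear_lie_monom //.
move/eqP: (fc (monom R v) (monom R w)); rewrite subr_eq0 => /eqP <-.
apply/esym; apply: etrans (w1tensorB _ _) _.
by congr (_ - _); exact: w1tensor_act.
Qed.

Lemma cocycle2_is_cocycle (f : L1 -> ext2 L1) : linear f ->
  is_cocycle2 om (fun v => w1tensor (f (monom R v))) -> is_cocycle f.
Proof.
move=> f_lin fc; split=> // x y.
have act_fl z : linear (fun x => act x (f z)) by exact: act_linl.
have act_fr z : linear (fun x => act z (f x)).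
  by move=> r p q /=; rewrite f_lin; exact: act_linr.
have f_liel z : linear (fun x => f (lie x z)).
  by move=> r p q /=; rewrite lie_linl; exact: f_lin.
have f_lier z : linear (fun x => f (lie z x)).
  by move=> r p q /=; rewrite lie_linr; exact: f_lin.
have lin1 z := linear_sub3 (act_fl z) (act_fr z) (f_liel z).
have lin2 z := linear_sub3 (act_fr z) (act_fl z) (f_lier z).
apply: (linear_monom_eq0 (lin1 y)) => v.
apply: (linear_monom_eq0 (lin2 (monom R v))) => w.
apply: w1tensor_inj; rewrite w1tensor0; apply: etrans (w1tensorB _ _) _.
apply/eqP; rewrite subr_eq0 linear_lie_monom // w1tensorZ -fc; apply/eqP.
apply: etrans (w1tensorB _ _) _; congr (_ - _); exact: w1tensor_act.
Qed.

Lemma Delta_linear (k : hom_expo R g) : linear (Delta k).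
Proof. exact: (@linext_linear R _ (ext2 L1)). Qed.

Lemma w1tensor_Delta (k : hom_expo R g) v :
  w1tensor (Delta k (monom R v)) = (k v : R) *: wedge1 R v.
Proof.
have -> : Delta k (monom R v) = (k v : R) *: wedge (monom R v) (monom R 0).
  by rewrite /Delta linextU.
rewrite w1tensorZ w1tensor_wedge; congr (_ *: _); exact: alt_tensorU.
Qed.

Lemma hom_expoD (k : hom_expo R g) v w : k (v + w) = k v + k w.
Proof.
case: k => k /= /asboolP kB; have k0 : k 0 = 0 by have := kB 0 0; rewrite !subrr.
have := kB v (- w); have := kB 0 w.
by rewrite sub0r opprK k0 sub0r => -> ->; rewrite opprK.
Qed.

Lemma hom_expo0 (k : hom_expo R g) : k 0 = 0.
Proof. by apply: (addrI (k 0)); rewrite -hom_expoD !addr0. Qed.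

Lemma Delta_cocycle (k : hom_expo R g) : Delta k \in cocycles L1 (ext2 L1).
Proof.
apply/asboolP/cocycle2_is_cocycle; first exact: Delta_linear.
rewrite (funext (w1tensor_Delta k)).
apply: (additive_cocycle2 (@intersectionDr g) (@intersectionC g)).
exact: hom_expoD.
Qed.

Fact linextZD (K : choiceType) (N : lmodType R) (f h : K -> R) (w : K -> N) r
    (x : {malg R[K]}) :
  linext (fun k => (r * f k + h k) *: w k) x =
  r *: linext (fun k => f k *: w k) x + linext (fun k => h k *: w k) x.
Proof.
rewrite /linext scaler_sumr -big_split; apply: eq_bigr => k _ /=.
by rewrite scalerDl scalerDr !scalerA; congr (_ *: _ + _); ring.
Qed.

Lemma H1class_Delta_linear :
  linear (fun k : hom_expo R g => H1class (MkZ1 (Delta_cocycle k))).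
Proof.
move=> r k l; rewrite /H1class -linearP; congr lmodpi; apply: val_inj.
apply: etrans (esym (linearP val r (MkZ1 (Delta_cocycle k)) _)).
apply/funext => x.
apply: (@linextZD _ (ext2 L1) k l (fun u => wedge (monom R u) (monom R 0)) r x).
Qed.

Lemma H1class_Delta_inj :
  injective (fun k : hom_expo R g => H1class (MkZ1 (Delta_cocycle k))).
Proof.
move=> k l /lmodpiP/asboolP[m].
move=> /(congr1 val); rewrite linearB /= => e.
have kl v : (k v : R) *: wedge1 R v - (l v : R) *: wedge1 R v =
    tact om v (w1tensor m).
  have e1 := etrans (congr1 (fun f : L1 -> ext2 L1 => w1tensor (f (monom R v))) e)
    (w1tensor_act v m).
  apply: etrans e1; rewrite -!w1tensor_Delta; exact: esym (w1tensorB _ _).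
apply/val_inj/funext => v; case: (eqVneq v 0) => [->|vn].
  by rewrite [LHS]hom_expo0 [RHS]hom_expo0.
exact: (tact_wedge1_eq0 (@intersectionDr g) (@intersectionC g) vn (kl v)).
Qed.

(** * Symplectic generators and surjectivity *)

Definition x_expo (j : 'I_g) : A := [ffun i => if i == j then (1, 0) else 0].
Definition y_expo (j : 'I_g) : A := [ffun i => if i == j then (0, 1) else 0].

Lemma intersection_x j v : om (x_expo j) v = (v j).2.
Proof.
rewrite /intersection (bigD1 j) //= !ffunE eqxx /= mul1r mulr0 subr0.
by rewrite big1 ?addr0 // => i /negPf ij; rewrite !ffunE ij mul0r mulr0 subr0.
Qed.

Lemma intersection_y j v : om (y_expo j) v = - (v j).1.
Proof.
rewrite /intersection (bigD1 j) //= !ffunE eqxx /= mul0r mulr1 sub0r.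
by rewrite big1 ?addr0 // => i /negPf ij; rewrite !ffunE ij mul0r mulr0 subr0.
Qed.

(** If y_j does not detect [p], some generator e does; should e be orthogonal to x_j, adding y_j
    repairs this without changing om e p. *)
Lemma ex_dual_vectors (j : 'I_g) : exists L : seq A, forall p, p != 0 ->
  exists2 v, v \in L & (W (x_expo j) v != 0) && (W v p != 0).
Proof.
pose B := [seq x_expo i | i <- enum 'I_g] ++ [seq y_expo i | i <- enum 'I_g].
exists (y_expo j :: B ++ [seq e + y_expo j | e <- B]) => p pn.
have xy : om (x_expo j) (y_expo j) = 1 by rewrite intersection_x ffunE eqxx.
case: (eqVneq (om (y_expo j) p) 0) => yp; last first.
  by exists (y_expo j); rewrite ?mem_head // xy !intr_eq0 yp.
have [e eB ep] : exists2 e, e \in B & om e p != 0.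
  have [i pi] : exists i, p i != 0.
    apply: contrapT => none; move/eqP: pn; apply; apply/ffunP => i.
    rewrite ffunE; apply/eqP; apply: contraT => pi; case: none.
    by exists i.
  case: (eqVneq (p i).2 0) => p2; last first.
    exists (x_expo i); last by rewrite intersection_x.
    by rewrite mem_cat map_f ?mem_enum.
  exists (y_expo i); first by rewrite mem_cat orbC map_f ?mem_enum.
  rewrite intersection_y oppr_eq0; apply: contraNneq pi => p1.
  by rewrite [p i]surjective_pairing p1 p2.
have omDl a b c : om (a + b) c = om a c + om b c.
  by rewrite !(intersectionC _ c) intersectionDr opprD.
case: (eqVneq (om (x_expo j) e) 0) => xe.
  exists (e + y_expo j).
    by rewrite inE mem_cat; apply/or3P/Or33/mapP; exists e.
  by rewrite intersectionDr xe xy omDl yp addr0 !intr_eq0 ep.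
exists e; first by rewrite inE mem_cat eB orbT.
by rewrite !intr_eq0 xe ep.
Qed.

Lemma H1class_Delta_onto (j : 'I_g) (q : H1 L1 (ext2 L1)) :
  exists k : hom_expo R g, H1class (MkZ1 (Delta_cocycle k)) = q.
Proof.
have [L LP] := ex_dual_vectors j.
have xy : om (x_expo j) (y_expo j) = 1 by rewrite intersection_x ffunE eqxx.
rewrite -(lmodreprK q); case: (lmodrepr q) => f fc.
have /asboolP [f_lin _] := fc.
have Fc : is_cocycle2 om (fun v => w1tensor (f (monom R v))).
  by apply: cocycle_is_cocycle2; apply/asboolP.
have [mu [K [muA KD FE]]] := cocycle2_normal_form (@intersectionDr g)
  (@intersectionC g) xy LP Fc (fun v => w1tensor_antisym _).
have Khom : (K : A -> R^o) \in @hom_expo_pred R g.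
  apply/asboolP => v w; apply/eqP; rewrite -subr_eq opprK; apply/eqP.
  by rewrite -KD subrK.
pose k := HomExpo Khom.
(* The sign is due to comparing Delta k - f, not f - Delta k, with a coboundary. *)
have [|m mE] := w1tensor_onto (phi := - mu).
  by move=> a b; rewrite !cfN (muA a).
exists k; apply/lmodpiP/asboolP; exists m; apply: val_inj.
apply: etrans (linearB val (MkZ1 (Delta_cocycle k)) (MkZ1 fc)) _.
apply/funext => x; apply/eqP; rewrite -subr_eq0; apply/eqP.
have lin := linear_sub3 (Delta_linear k) f_lin (act_linl m).
apply: (linear_monom_eq0 lin) => v.
apply: w1tensor_inj; rewrite w1tensor0; apply: etrans (w1tensorB _ _) _.
rewrite [X in X - _]w1tensorB [X in X - _ - _]w1tensor_Delta.
rewrite [X in _ - X - _]FE [X in _ - X]w1tensor_act mE.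
by rewrite linearN opprK opprD; zmodule.
Qed.

End WilsonLoops.

Theorem mainTheorem1 (R : realType) (g : nat) (hg : (0 < g)%N) :
  exists Delta_cocycle : forall k : hom_expo R g,
      @Delta R g k \in cocycles (W1 R g) (ext2 (W1 R g)),
    let Phi : hom_expo R g -> H1 (W1 R g) (ext2 (W1 R g)) :=
      fun k => H1class (MkZ1 (Delta_cocycle k)) in
    linear Phi /\ bijective Phi.
Proof.
exists (@Delta_cocycle R g); split; first exact: H1class_Delta_linear.
(* Positive genus supplies the index j for which u = x_j and v0 = y_j. *)
have [h hK] := choice (@H1class_Delta_onto R g (Ordinal hg)).
by exists h => // k; apply: H1class_Delta_inj; rewrite hK.
Qed.
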